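(* Let $\Bbbk$ be an algebraically closed field of characteristic zero, let $\lambda\in\Bbbk$ with $\lambda\neq0$, let $\mathfrak U=\mathfrak U(\lambda)$ be the algebra presented in the context, and for $\alpha\in\Bbbk$ let $\mathfrak U^\alpha=\mathfrak U/\langle\Omega-\alpha\rangle$ where $\Omega=x^2g^{-1}-2\lambda(g^{-1}+g)$. Let $h,e,f\in\mathfrak U^\alpha$ be the elements defined in the context and let $\mathcal B$ be the subalgebra of $\mathfrak U^\alpha$ generated by $h,e,f$. (1) Suppose $\alpha\neq\pm4\lambda$. Then $\mathcal B\cong\Bbbk[e^{\pm1}][h;\partial]$, where $\partial$ is the derivation of $\Bbbk[e^{\pm1}]$ determined by $\partial(e)=e$. Furthermore, $\mathfrak U^\alpha$ is isomorphic to the localization of $\mathcal B$ at the powers of the element $\tilde g:=e^2+\frac{\alpha}{\sqrt{2\lambda}}e+\frac1{8\lambda}(\alpha^2-16\lambda^2)$; more precisely, $$\mathfrak U^\alpha\cong\mathcal B_{\tilde g}\cong\Bbbk[e^{\pm1}]_{\tilde g}[h;\partial].$$ In particular, $\mathfrak U^\alpha$ is a simple domain. (2) Suppose $\alpha=\pm4\lambda$. Then $\mathcal B\cong\frac{\Bbbk[e,f]}{\langle ef\rangle}[h;\partial]$, where $\partial$ is the derivation determined by $\partial(e)=e$ and $\partial(f)=-f$. Furthermore, $\mathfrak U^\alpha$ is isomorphic to the localization of $\mathcal B$ at the powers of the element $g':=e-f+\frac{\alpha}{\sqrt{2\lambda}}$; more precisely, $$\mathfrak U^\alpha\cong\mathcal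 B_{g'}\cong\Big(\frac{\Bbbk[e,f]}{\langle ef\rangle}\Big)_{g'}[h;\partial].$$ In this case, $\mathfrak U^\alpha$ is neither simple nor a domain.
   Context: $\mathfrak U(\lambda)$ is the associative unital $\Bbbk$-algebra generated by $g^{\pm1},x,y$ with relations $gg^{-1}=g^{-1}g=1$, $gxg^{-1}=x$, $gyg^{-1}=y+x$, $yx-xy=-\tfrac12x^2+\lambda(1-g^2)$. The element $\Omega$ is central in $\mathfrak U$. Fix a square root $\sqrt{2\lambda}\in\Bbbk$. In $\mathfrak U^\alpha$ put $$h:=\frac1{\sqrt{2\lambda}}yg^{-1},\qquad e:=x-\sqrt{2\lambda}\,g-\frac{\alpha}{2\sqrt{2\lambda}},\qquad f:=x+\sqrt{2\lambda}\,g+\frac{\alpha}{2\sqrt{2\lambda}}.$$ For a ring $A$ with derivation $\partial$, $A[h;\partial]$ denotes the Ore extension with $ha-ah=\partial(a)$ for $a\in A$. A subscript on a ring denotes localization at the powers of the given element, and a derivation extended to a localization is denoted by the same symbol. *)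

(* Defs.v *)
From HB Require Import structures.
From mathcomp Require Import all_boot all_order all_algebra.
From mathcomp Require Import generic_quotient ring_quotient boolp.
From mathcomp Require Import -(notations) monalg.
From mathcomp Require Import mpoly.

Set Implicit Arguments.
Unset Strict Implicit.
Unset Printing Implicit Defensive.

Import GRing.Theory.
Local Open Scope ring_scope.
Local Open Scope quotient_scope.

Reserved Notation "c %:K" (left associativity, format "c %:K").

(* Unital associative algebras over [K], as rings with a central ring morphism
   from [K].  Unlike for [algType K], [1 != 0] is not required, since an
   algebra given by generators and relations may a priori be zero; the library
   hierarchy has no room for a common substructure of [algType K] and
   [pzRingType] carrying a scaling operation. *)
HB.mixin Record isPzAlgebra (K : pzRingType) A of GRing.PzRing A := {
  scal : K -> A;
  scal_zmod : zmod_morphism scal;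
  scal_monoid : monoid_morphism scal;
  scalC : forall (c : K) (a : A), scal c * a = a * scal c
}.

#[short(type="pzAlgType")]
HB.structure Definition PzAlgebra (K : pzRingType) :=
  {A of GRing.PzRing A & isPzAlgebra K A}.

Notation "c %:K" := (scal c) : ring_scope.

HB.instance Definition _ (K : pzRingType) (A : pzAlgType K) :=
  GRing.isZmodMorphism.Build K A scal scal_zmod.
HB.instance Definition _ (K : pzRingType) (A : pzAlgType K) :=
  GRing.isMonoidMorphism.Build K A scal scal_monoid.

HB.instance Definition _ (K : fieldType) :=
  isPzAlgebra.Build K {poly K} (raddfB polyC) (rmorphism_monoidP polyC)
    (fun c p => mulrC c%:P p).

HB.instance Definition _ (K : fieldType) n :=
  isPzAlgebra.Build K {mpoly K[n]} (raddfB (@mpolyC n K))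
    (rmorphism_monoidP (@mpolyC n K)) (fun c p => mulrC (@mpolyC n K c) p).

Definition alg_iso (K : fieldType) (A B : pzAlgType K)
    (phi : {rmorphism A -> B}) : Prop :=
  (forall c : K, phi c%:K = c%:K) /\ bijective phi.

Definition two_sided_ideal (A : pzRingType) (I : A -> Prop) : Prop :=
  [/\ I 0, forall a b, I a -> I b -> I (a + b),
      forall a b, I b -> I (a * b) & forall a b, I b -> I (b * a)].

Definition simple_ring (A : pzRingType) : Prop :=
  (1 : A) <> 0 /\
  forall I : A -> Prop, two_sided_ideal I ->
    (forall a, I a -> a = 0) \/ (forall a, I a).

Definition domain (A : pzRingType) : Prop :=
  (1 : A) <> 0 /\ forall a b : A, a * b = 0 -> a = 0 \/ b = 0.

Section Quotient.
Variables (K : fieldType) (A : pzAlgType K) (S : A -> Prop).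

Inductive gen_ideal : A -> Prop :=
| gen_ideal0 : gen_ideal 0
| gen_ideal_gen a : S a -> gen_ideal a
| gen_idealD a b : gen_ideal a -> gen_ideal b -> gen_ideal (a + b)
| gen_idealMl a b : gen_ideal b -> gen_ideal (a * b)
| gen_idealMr a b : gen_ideal b -> gen_ideal (b * a).

Definition ideal_pred : {pred A} := fun a => `[< gen_ideal a >].

Lemma ideal_predP a : reflect (gen_ideal a) (a \in ideal_pred).
Proof. exact: asboolP. Qed.

Lemma ideal_pred_zmod_closed : zmod_closed ideal_pred.
Proof.
split=> [|a b /ideal_predP Ia /ideal_predP Ib]; apply/ideal_predP.
  exact: gen_ideal0.
by rewrite -mulN1r; apply: gen_idealD => //; apply: gen_idealMl.
Qed.

HB.instance Definition _ := GRing.isZmodClosed.Build A ideal_pred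
  ideal_pred_zmod_closed.

Definition quot_alg := Quotient.quot ideal_pred.

HB.instance Definition _ := GRing.Zmodule.on quot_alg.
HB.instance Definition _ : EqQuotient A (Quotient.equiv ideal_pred) quot_alg :=
  EqQuotient.on quot_alg.

End Quotient.

(* The operations below are sealed to keep conversion tests from unfolding the
   constructions. *)
HB.lock Definition quot_pi (K : fieldType) (A : pzAlgType K) (S : A -> Prop)
  (a : A) : quot_alg S := \pi_(quot_alg S) a.

HB.lock Definition quot_mul (K : fieldType) (A : pzAlgType K) (S : A -> Prop)
  (p q : quot_alg S) : quot_alg S := quot_pi S (repr p * repr q).

Section QuotientTheory.
Variables (K : fieldType) (A : pzAlgType K) (S : A -> Prop).

Local Notation quot_alg := (quot_alg S).
Local Notation quot_pi := (quot_pi S).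
Local Notation quot_mul := (@quot_mul K A S).
Local Notation gen_ideal := (gen_ideal S).

Lemma quot_piP a b : quot_pi a = quot_pi b <-> gen_ideal (a - b).
Proof.
rewrite unlock; split=> [/eqP|/ideal_predP ab]; last by apply/eqP; rewrite piE.
by rewrite piE => /ideal_predP.
Qed.

Lemma quot_piK q : quot_pi (repr q) = q.
Proof. by rewrite unlock reprK. Qed.

Lemma quot_pi_zmod : zmod_morphism quot_pi.
Proof. by move=> a b; rewrite unlock !piE. Qed.

Definition quot_one : quot_alg := quot_pi 1.

Lemma quot_repr a : gen_ideal (repr (quot_pi a) - a).
Proof. by apply/quot_piP; rewrite quot_piK. Qed.

Lemma quot_mulE a b : quot_mul (quot_pi a) (quot_pi b) = quot_pi (a * b).
Proof.
rewrite quot_mul.unlock; apply/quot_piP; set a' := repr _; set b' := repr _.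
have -> : a' * b' - a * b = (a' - a) * b' + a * (b' - b).
  by rewrite mulrBl mulrBr addrA subrK.
by apply: gen_idealD; [apply: gen_idealMr|apply: gen_idealMl];
  apply: quot_repr.
Qed.

Lemma quot_addE a b : quot_pi a + quot_pi b = quot_pi (a + b).
Proof. by rewrite unlock !piE. Qed.

Let ind (P : quot_alg -> Prop) : (forall a, P (quot_pi a)) -> forall q, P q.
Proof. by move=> H q; rewrite -(quot_piK q). Qed.

Lemma quot_mulA : associative quot_mul.
Proof.
by elim/ind=> a; elim/ind=> b; elim/ind=> c; rewrite !quot_mulE mulrA.
Qed.
Lemma quot_mul1q : left_id quot_one quot_mul.
Proof. by elim/ind=> a; rewrite quot_mulE mul1r. Qed.
Lemma quot_mulq1 : right_id quot_one quot_mul.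
Proof. by elim/ind=> a; rewrite quot_mulE mulr1. Qed.
Lemma quot_mulDl : left_distributive quot_mul +%R.
Proof.
elim/ind=> a; elim/ind=> b; elim/ind=> c.
by rewrite quot_addE !quot_mulE quot_addE mulrDl.
Qed.
Lemma quot_mulDr : right_distributive quot_mul +%R.
Proof.
elim/ind=> a; elim/ind=> b; elim/ind=> c.
by rewrite quot_addE !quot_mulE quot_addE mulrDr.
Qed.

HB.instance Definition _ := GRing.Zmodule_isPzRing.Build quot_alg
  quot_mulA quot_mul1q quot_mulq1 quot_mulDl quot_mulDr.

Lemma quot_pi_monoid : monoid_morphism quot_pi.
Proof. by split=> // a b; rewrite -quot_mulE. Qed.

HB.instance Definition _ :=
  GRing.isZmodMorphism.Build A quot_alg quot_pi quot_pi_zmod.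
HB.instance Definition _ :=
  GRing.isMonoidMorphism.Build A quot_alg quot_pi quot_pi_monoid.
Definition quot_scal (c : K) : quot_alg := quot_pi c%:K.

Lemma quot_scal_zmod : zmod_morphism quot_scal.
Proof. by move=> c d; rewrite /quot_scal !rmorphB. Qed.
Lemma quot_scal_monoid : monoid_morphism quot_scal.
Proof. by split=> [|c d]; rewrite /quot_scal ?rmorph1 ?rmorphM. Qed.
Lemma quot_scalC c q : quot_scal c * q = q * quot_scal c.
Proof. by elim/ind: q => a; rewrite /quot_scal -!rmorphM scalC. Qed.

HB.instance Definition _ := isPzAlgebra.Build K quot_alg
  quot_scal_zmod quot_scal_monoid quot_scalC.

End QuotientTheory.

(* The free algebra [K<I>] is the monoid algebra of the free monoid on [I]. *)
Definition free_alg (K : fieldType) (I : choiceType) :=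
  monalg.malg (monalg.fmonom I) K.

HB.instance Definition _ (K : fieldType) (I : choiceType) :=
  GRing.Zmodule.on (free_alg K I).

HB.lock Definition free_mul (K : fieldType) (I : choiceType)
    (p q : free_alg K I) : free_alg K I :=
  (p : monalg.malg (monalg.fmonom I) K) * q.

HB.lock Definition free_scal (K : fieldType) (I : choiceType) (c : K) :
  free_alg K I := monalg.mkmalgU monalg.mone c.

HB.lock Definition gen (K : fieldType) (I : choiceType) (i : I) :
  free_alg K I := monalg.mkmalgU (monalg.fmu i) 1.

Section FreeAlgebra.
Variables (K : fieldType) (I : choiceType).

Local Notation malg := (monalg.malg (monalg.fmonom I) K).
Local Notation free_mul := (@free_mul K I).
Local Notation free_scal := (@free_scal K I).

Lemma free_mulA : associative free_mul.
Proof. by rewrite free_mul.unlock; apply: (@mulrA malg). Qed.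
Lemma free_mul1p : left_id (free_scal 1) free_mul.
Proof.
by rewrite free_mul.unlock free_scal.unlock; apply: (@mul1r malg).
Qed.
Lemma free_mulp1 : right_id (free_scal 1) free_mul.
Proof.
by rewrite free_mul.unlock free_scal.unlock; apply: (@mulr1 malg).
Qed.
Lemma free_mulDl : left_distributive free_mul +%R.
Proof. by rewrite free_mul.unlock; apply: (@mulrDl malg). Qed.
Lemma free_mulDr : right_distributive free_mul +%R.
Proof. by rewrite free_mul.unlock; apply: (@mulrDr malg). Qed.

HB.instance Definition _ := GRing.Zmodule_isPzRing.Build (free_alg K I)
  free_mulA free_mul1p free_mulp1 free_mulDl free_mulDr.

Lemma free_mulE (p q : free_alg K I) : p * q = (p : malg) * (q : malg) :> malg.
Proof. by rewrite {1}/GRing.mul /= free_mul.unlock. Qed.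

Lemma free_scal_zmod : zmod_morphism free_scal.
Proof. by rewrite free_scal.unlock; apply: raddfB. Qed.
Lemma free_scal_monoid : monoid_morphism free_scal.
Proof.
split=> // c d; rewrite free_mulE free_scal.unlock.
by apply: (rmorphM (monalg.mkmalgU _)).
Qed.
Lemma free_scalC c p : free_scal c * p = p * free_scal c.
Proof.
rewrite !free_mulE free_scal.unlock !monalg.malgM_def monalg.fgmulUg monalg.fgmulgU.
by apply: eq_bigr => k _; rewrite monalg.mul1m monalg.mulm1 mulrC.
Qed.

HB.instance Definition _ := isPzAlgebra.Build K (free_alg K I)
  free_scal_zmod free_scal_monoid free_scalC.

End FreeAlgebra.

Section Subalgebra.
Variables (K : fieldType) (A : pzAlgType K) (S : A -> Prop).

Inductive gen_subalg : A -> Prop :=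
| gen_subalg_gen a : S a -> gen_subalg a
| gen_subalg_scal c : gen_subalg c%:K
| gen_subalgD a b : gen_subalg a -> gen_subalg b -> gen_subalg (a + b)
| gen_subalgM a b : gen_subalg a -> gen_subalg b -> gen_subalg (a * b).

Definition subalg_pred : {pred A} := fun a => `[< gen_subalg a >].

Lemma subalg_predP a : reflect (gen_subalg a) (a \in subalg_pred).
Proof. exact: asboolP. Qed.

Record subalg := Subalg {
  subalg_val : A;
  subalg_valP : subalg_val \in subalg_pred
}.

HB.instance Definition _ := [isSub for subalg_val].
HB.instance Definition _ := [Choice of subalg by <:].

Lemma subalg_subring_closed : subring_closed subalg_pred.
Proof.
split=> [|a b /subalg_predP Ba /subalg_predP Bb
         |a b /subalg_predP Ba /subalg_predP Bb]; apply/subalg_predP.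
- by rewrite -(rmorph1 (@scal K A)); apply: gen_subalg_scal.
- rewrite -mulN1r -(rmorphN1 (@scal K A)); apply: gen_subalgD => //.
  by apply: gen_subalgM => //; apply: gen_subalg_scal.
- exact: gen_subalgM.
Qed.

HB.instance Definition _ := GRing.SubChoice_isSubPzRing.Build A _ subalg
  subalg_subring_closed.

Lemma subalg_scal_in c : c%:K \in subalg_pred.
Proof. exact/subalg_predP/gen_subalg_scal. Qed.

Definition subalg_scal (c : K) : subalg := Subalg (subalg_scal_in c).

Lemma subalg_scal_zmod : zmod_morphism subalg_scal.
Proof. by move=> c d; apply: val_inj; rewrite /= !rmorphB. Qed.
Lemma subalg_scal_monoid : monoid_morphism subalg_scal.
Proof. by split=> [|c d]; apply: val_inj; rewrite /= ?rmorph1 ?rmorphM. Qed.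
Lemma subalg_scalC c a : subalg_scal c * a = a * subalg_scal c.
Proof. by apply: val_inj; rewrite !rmorphM /= scalC. Qed.

HB.instance Definition _ := isPzAlgebra.Build K subalg
  subalg_scal_zmod subalg_scal_monoid subalg_scalC.

Lemma subalg_gen_in a : S a -> a \in subalg_pred.
Proof. by move=> Sa; apply/subalg_predP/gen_subalg_gen. Qed.

Definition subalg_gen a (Sa : S a) : subalg := Subalg (subalg_gen_in Sa).

End Subalgebra.

Section Localization.
Variables (K : fieldType) (A : pzAlgType K) (s : A).

Local Notation F := (free_alg K (option A)).
Local Notation "[ a ]" := (gen K (Some a)).
Local Notation t := (gen K (None : option A)).

(* The universal [K]-algebra under [A] in which [s] is invertible: generators
   the elements of [A] and a letter [t], subject to the relations holding
   in [A] and to [s t = t s = 1]. *)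
Inductive loc_rel : F -> Prop :=
| loc_relD a b : loc_rel ([a + b] - ([a] + [b]))
| loc_relM a b : loc_rel ([a * b] - [a] * [b])
| loc_rel_scal c : loc_rel ([c%:K] - c%:K)
| loc_rel_sV : loc_rel ([s] * t - 1)
| loc_rel_Vs : loc_rel (t * [s] - 1).

Definition loc := quot_alg loc_rel.
HB.instance Definition _ := PzAlgebra.on loc.

Definition loc_in (a : A) : loc := quot_pi loc_rel [a].

Lemma loc_in_scal (c : K) : loc_in c%:K = c%:K.
Proof. exact/quot_piP/gen_ideal_gen/loc_rel_scal. Qed.

Lemma loc_inD : {morph loc_in : a b / a + b}.
Proof.
move=> a b; rewrite -rmorphD.
exact/quot_piP/gen_ideal_gen/loc_relD.
Qed.

Lemma loc_in_zmod : zmod_morphism loc_in.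
Proof. by move=> a b; apply/eqP; rewrite eq_sym subr_eq -loc_inD subrK. Qed.

Lemma loc_in_monoid : monoid_morphism loc_in.
Proof.
split=> [|a b]; first by rewrite -(rmorph1 (@scal K A)) loc_in_scal rmorph1.
by rewrite -rmorphM; apply/quot_piP/gen_ideal_gen/loc_relM.
Qed.

HB.instance Definition _ := GRing.isZmodMorphism.Build A loc loc_in loc_in_zmod.
HB.instance Definition _ :=
  GRing.isMonoidMorphism.Build A loc loc_in loc_in_monoid.

End Localization.

(* [A -> L] makes [L] the left and right ring of fractions of [A] at the
   powers of [s]. *)
Definition ore_localization (A L : pzRingType) (s : A)
    (iota : {rmorphism A -> L}) : Prop :=
  [/\ exists t : L, iota s * t = 1 /\ t * iota s = 1,
      forall x : L, exists a n, x * iota s ^+ n = iota a,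
      forall x : L, exists a n, iota s ^+ n * x = iota a,
      forall a : A, iota a = 0 -> exists n, a * s ^+ n = 0
    & forall a : A, iota a = 0 -> exists n, s ^+ n * a = 0].

Section Derivation.
Variables (K : fieldType) (A : pzAlgType K).

Record derivation := Derivation {
  der_fun :> A -> A;
  derD : {morph der_fun : a b / a + b};
  derM : forall a b, der_fun (a * b) = der_fun a * b + a * der_fun b;
  der_scal : forall c : K, der_fun c%:K = 0
}.

Definition determined_by (P : derivation -> Prop) (d : derivation) : Prop :=
  P d /\ forall d' : derivation, P d' -> d' =1 d.

End Derivation.

Definition der_extends (K : fieldType) (A L : pzAlgType K)
    (iota : {rmorphism A -> L}) (d : derivation A) (d' : derivation L) : Prop :=
  forall a, d' (iota a) = iota (d a).

Section AdditiveExtension.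
Variables (G V : zmodType) (F : nat -> G -> V).
Hypothesis FD : forall n, {morph F n : a b / a + b}.
Import finmap.
Local Open Scope fset_scope.
Local Open Scope ring_scope.
Implicit Types p q : monalg.malg nat G.

Definition mext p : V := \sum_(n <- monalg.msupp p) F n (monalg.mcoeff n p).

Let F0 n : F n 0 = 0.
Proof. by apply: (addrI (F n 0)); rewrite -FD !addr0. Qed.

Lemma mextEw (d : {fset nat}) p : monalg.msupp p `<=` d ->
  mext p = \sum_(n <- d) F n (monalg.mcoeff n p).
Proof.
move=> le; rewrite /mext (big_fset_incl _ le) //= => n _ np.
by rewrite monalg.mcoeff_outdom // F0.
Qed.

Lemma mextD : {morph mext : p q / p + q}.
Proof.
move=> p q; pose d := monalg.msupp p `|` monalg.msupp q.
rewrite (@mextEw d) ?monalg.msuppD_le // (@mextEw d p) ?fsubsetUl //.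
rewrite (@mextEw d q) ?fsubsetUr // -big_split /=.
by apply: eq_bigr => n _; rewrite monalg.mcoeffD FD.
Qed.

Lemma mextU a n : mext (monalg.mkmalgU n a) = F n a.
Proof.
by rewrite (mextEw monalg.msuppU_le) big_seq_fset1 monalg.mcoeffUU.
Qed.

End AdditiveExtension.

(* The left [A]-module underlying [A[h; d]]: finite sums of terms [a h^n].  The
   derivation, which only enters the multiplication, is a phantom argument. *)
Definition ore_ext (K : fieldType) (A : pzAlgType K) (d : derivation A) :=
  monalg.malg nat A.

HB.instance Definition _ (K : fieldType) (A : pzAlgType K) (d : derivation A) :=
  GRing.Zmodule.on (ore_ext d).

(* [a h^n] *)
HB.lock Definition ore_term (K : fieldType) (A : pzAlgType K)
    (d : derivation A) (a : A) (n : nat) : ore_ext d := monalg.mkmalgU n a.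

Section OreExtensionDef.
Variables (K : fieldType) (A : pzAlgType K) (d : derivation A).

Local Notation ore := (ore_ext d).
Local Notation ore_term := (@ore_term K A d).

Definition ore_lmul (a : A) : ore -> ore :=
  mext (fun n b => ore_term (a * b) n).

(* Left multiplication by [h]: [h (b h^n) = b h^(n+1) + d(b) h^n]. *)
Definition ore_hmul : ore -> ore :=
  mext (fun n b => ore_term b n.+1 + ore_term (d b) n).

End OreExtensionDef.

(* [(a h^n) q = a (h (... (h q)))], with [n] factors [h]. *)
HB.lock Definition ore_mul (K : fieldType) (A : pzAlgType K) (d : derivation A)
    (p q : ore_ext d) : ore_ext d :=
  mext (fun n a => ore_lmul a (iter n (@ore_hmul K A d) q)) p.

Section OreExtension.
Variables (K : fieldType) (A : pzAlgType K) (d : derivation A).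

Local Notation ore := (ore_ext d).
Local Notation ore_term := (@ore_term K A d).
Local Notation ore_lmul := (@ore_lmul K A d).
Local Notation ore_hmul := (@ore_hmul K A d).
Local Notation ore_mul := (@ore_mul K A d).

Definition ore_one : ore := ore_term 1 0.

Lemma der0 : d 0 = 0.
Proof. by have := der_scal d 0; rewrite rmorph0. Qed.

Lemma der1 : d 1 = 0.
Proof. by have := der_scal d 1; rewrite rmorph1. Qed.

Lemma ore_termU a n : ore_term a n = monalg.mkmalgU n a.
Proof. by rewrite ore_term.unlock. Qed.

Lemma ore_termD n : {morph ore_term^~ n : a b / a + b}.
Proof. by move=> a b; rewrite !ore_termU; apply: monalg.monalgUD. Qed.

Lemma ore_term0 n : ore_term 0 n = 0.
Proof. by rewrite ore_termU; apply: monalg.monalgU0. Qed.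

Lemma ore_ind (P : ore -> Prop) :
  (forall a n, P (ore_term a n)) ->
  (forall p q, P p -> P q -> P (p + q)) -> forall p, P p.
Proof.
move=> PU PD p; rewrite [p]monalg.monalgE.
by apply: big_ind => [||n _]; [rewrite -(ore_term0 0)|apply: PD|rewrite -ore_termU; apply: PU].
Qed.

Lemma ore_lmul_subproof a n :
  {morph (fun b => ore_term (a * b) n) : b c / b + c}.
Proof. by move=> b c; rewrite mulrDr ore_termD. Qed.

Lemma ore_lmulD a : {morph ore_lmul a : p q / p + q}.
Proof. exact/mextD/ore_lmul_subproof. Qed.

Lemma ore_lmul_term a b n : ore_lmul a (ore_term b n) = ore_term (a * b) n.
Proof. by rewrite ore_termU; apply/mextU/ore_lmul_subproof. Qed.

Lemma ore_lmulDl a b p : ore_lmul (a + b) p = ore_lmul a p + ore_lmul b p.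
Proof.
elim/ore_ind: p => [c n|p q IHp IHq].
  by rewrite !ore_lmul_term mulrDl ore_termD.
by rewrite !ore_lmulD IHp IHq addrACA.
Qed.

Lemma ore_lmulA a b p : ore_lmul a (ore_lmul b p) = ore_lmul (a * b) p.
Proof.
elim/ore_ind: p => [c n|p q IHp IHq]; first by rewrite !ore_lmul_term mulrA.
by rewrite !ore_lmulD IHp IHq.
Qed.

Lemma ore_lmul1 p : ore_lmul 1 p = p.
Proof.
elim/ore_ind: p => [c n|p q IHp IHq]; first by rewrite ore_lmul_term mul1r.
by rewrite ore_lmulD IHp IHq.
Qed.

Lemma ore_hmul_subproof n :
  {morph (fun b => ore_term b n.+1 + ore_term (d b) n) : a b / a + b}.
Proof. by move=> a b; rewrite derD !ore_termD addrACA. Qed.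

Lemma ore_hmulD : {morph ore_hmul : p q / p + q}.
Proof. exact/mextD/ore_hmul_subproof. Qed.

Lemma ore_hmul_term b n :
  ore_hmul (ore_term b n) = ore_term b n.+1 + ore_term (d b) n.
Proof. by rewrite ore_termU; apply/mextU/ore_hmul_subproof. Qed.

Lemma ore_hlmul a p :
  ore_hmul (ore_lmul a p) = ore_lmul a (ore_hmul p) + ore_lmul (d a) p.
Proof.
elim/ore_ind: p => [c n|p q IHp IHq].
  rewrite ore_lmul_term !ore_hmul_term ore_lmulD !ore_lmul_term derM.
  by rewrite ore_termD [ore_term (d a * c) n + _]addrC addrA.
by rewrite !(ore_lmulD, ore_hmulD) IHp IHq addrACA.
Qed.

Lemma ore_hmul_iterD n p q :
  iter n ore_hmul (p + q) = iter n ore_hmul p + iter n ore_hmul q.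
Proof. by elim: n => //= n ->; rewrite ore_hmulD. Qed.

Lemma ore_mul_subproof q n :
  {morph (fun a => ore_lmul a (iter n ore_hmul q)) : a b / a + b}.
Proof. by move=> a b; apply: ore_lmulDl. Qed.

Lemma ore_mul_term a n q :
  ore_mul (ore_term a n) q = ore_lmul a (iter n ore_hmul q).
Proof.
by rewrite ore_mul.unlock ore_termU; apply: (mextU (ore_mul_subproof q)).
Qed.

Lemma ore_mulDl : left_distributive ore_mul +%R.
Proof.
by move=> p q r; rewrite unlock; apply: (mextD (ore_mul_subproof r)).
Qed.

Lemma ore_mulDr : right_distributive ore_mul +%R.
Proof.
move=> p q r; elim/ore_ind: p => [a n|p p' IHp IHp'].
  by rewrite !ore_mul_term ore_hmul_iterD ore_lmulD.
by rewrite !ore_mulDl IHp IHp' addrACA.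
Qed.

Lemma ore_mul_lmul a q r : ore_mul (ore_lmul a q) r = ore_lmul a (ore_mul q r).
Proof.
elim/ore_ind: q => [b n|p q IHp IHq].
  by rewrite ore_lmul_term !ore_mul_term ore_lmulA.
by rewrite !(ore_lmulD, ore_mulDl) IHp IHq.
Qed.

Lemma ore_mul_hmul q r : ore_mul (ore_hmul q) r = ore_hmul (ore_mul q r).
Proof.
elim/ore_ind: q => [b n|p q IHp IHq].
  by rewrite ore_hmul_term ore_mulDl !ore_mul_term /= ore_hlmul.
by rewrite !(ore_hmulD, ore_mulDl) IHp IHq.
Qed.

Lemma ore_mulA : associative ore_mul.
Proof.
move=> p q r; elim/ore_ind: p => [a n|p p' IHp IHp'].
  rewrite !ore_mul_term ore_mul_lmul; congr ore_lmul.
  by elim: n => //= n ->; rewrite ore_mul_hmul.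
by rewrite !ore_mulDl IHp IHp'.
Qed.

Lemma ore_mul1p : left_id ore_one ore_mul.
Proof. by move=> p; rewrite ore_mul_term /= ore_lmul1. Qed.

Lemma ore_hmul_one n : iter n ore_hmul ore_one = ore_term 1 n.
Proof.
by elim: n => //= n ->; rewrite ore_hmul_term der1 ore_term0 addr0.
Qed.

Lemma ore_mulp1 : right_id ore_one ore_mul.
Proof.
move=> p; elim/ore_ind: p => [a n|p q IHp IHq].
  by rewrite ore_mul_term ore_hmul_one ore_lmul_term mulr1.
by rewrite ore_mulDl IHp IHq.
Qed.

HB.instance Definition _ := GRing.Zmodule_isPzRing.Build ore
  ore_mulA ore_mul1p ore_mulp1 ore_mulDl ore_mulDr.

Definition ore_h : ore := ore_term 1 1.

Definition ore_in (a : A) : ore := ore_term a 0.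

Lemma ore_in_zmod : zmod_morphism ore_in.
Proof.
by move=> a b; rewrite /ore_in !ore_termU; apply: monalg.monalgUB.
Qed.

Lemma ore_in_monoid : monoid_morphism ore_in.
Proof.
split=> // a b; rewrite /GRing.mul /= /ore_in ore_mul_term /=.
by rewrite ore_lmul_term.
Qed.

HB.instance Definition _ := GRing.isZmodMorphism.Build A ore ore_in ore_in_zmod.
HB.instance Definition _ :=
  GRing.isMonoidMorphism.Build A ore ore_in ore_in_monoid.

Lemma ore_h_comm a : ore_h * ore_in a - ore_in a * ore_h = ore_in (d a).
Proof.
rewrite /GRing.mul /= /ore_h /ore_in !ore_mul_term /= ore_lmul1.
by rewrite ore_hmul_term ore_lmul_term mulr1 addrAC subrr add0r.
Qed.

Lemma ore_termE a n : ore_term a n = ore_in a * ore_h ^+ n.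
Proof.
suff -> : ore_h ^+ n = ore_term 1 n.
  by rewrite /GRing.mul /= ore_mul_term /= ore_lmul_term mulr1.
elim: n => // n IHn; rewrite exprS IHn /GRing.mul /= ore_mul_term /= ore_lmul1.
by rewrite ore_hmul_term der1 ore_term0 addr0.
Qed.

Definition ore_scal (c : K) : ore := ore_in c%:K.

Lemma ore_scal_zmod : zmod_morphism ore_scal.
Proof. by move=> a b; rewrite /ore_scal !rmorphB. Qed.
Lemma ore_scal_monoid : monoid_morphism ore_scal.
Proof. by split=> [|a b]; rewrite /ore_scal ?rmorph1 ?rmorphM. Qed.

Lemma ore_scal_hmul c n q :
  iter n ore_hmul (ore_lmul c%:K q) = ore_lmul c%:K (iter n ore_hmul q).
Proof.
elim: n => //= n ->; rewrite ore_hlmul der_scal.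
have -> : ore_lmul 0 (iter n ore_hmul q) = 0.
  by apply: (addrI (ore_lmul 0 (iter n ore_hmul q))); rewrite -ore_lmulDl !addr0.
by rewrite addr0.
Qed.

Lemma ore_scalC c p : ore_scal c * p = p * ore_scal c.
Proof.
elim/ore_ind: p => [a n|p q IHp IHq]; last by rewrite mulrDl mulrDr IHp IHq.
have ec : ore_scal c = ore_lmul c%:K ore_one.
  by rewrite ore_lmul_term mulr1.
rewrite {2}ec /GRing.mul /= !ore_mul_term /= ore_scal_hmul ore_hmul_one.
by rewrite !ore_lmul_term mulr1 scalC.
Qed.

HB.instance Definition _ := isPzAlgebra.Build K ore
  ore_scal_zmod ore_scal_monoid ore_scalC.

End OreExtension.

(* [K[e, e^-1]] *)
Definition laurent (K : fieldType) := loc ('X : {poly K}).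
HB.instance Definition _ (K : fieldType) := PzAlgebra.on (laurent K).

Definition laurent_e (K : fieldType) : laurent K := loc_in 'X 'X.

(* [K[e, f] / (ef)], with [e], [f] the two variables of [{mpoly K[2]}] *)
Definition cross_e0 (K : fieldType) : {mpoly K[2]} := 'X_(@Ordinal 2 0 isT).
Definition cross_f0 (K : fieldType) : {mpoly K[2]} := 'X_(@Ordinal 2 1 isT).
Definition cross (K : fieldType) :=
  quot_alg (fun p : {mpoly K[2]} => p = cross_e0 K * cross_f0 K).
HB.instance Definition _ (K : fieldType) := PzAlgebra.on (cross K).

Definition cross_e (K : fieldType) : cross K := quot_pi _ (cross_e0 K).
Definition cross_f (K : fieldType) : cross K := quot_pi _ (cross_f0 K).

Inductive Ugen := Ug | UgV | Ux | Uy.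

Definition Ugen_code (i : Ugen) : 'I_4 :=
  match i with
  | Ug => @Ordinal 4 0 isT | UgV => @Ordinal 4 1 isT
  | Ux => @Ordinal 4 2 isT | Uy => @Ordinal 4 3 isT
  end.
Definition Ugen_decode (i : 'I_4) : Ugen :=
  match val i with 0 => Ug | 1 => UgV | 2 => Ux | _ => Uy end.
Lemma Ugen_codeK : cancel Ugen_code Ugen_decode.
Proof. by case. Qed.
HB.instance Definition _ := Finite.copy Ugen (can_type Ugen_codeK).

Section U.
Variables (K : fieldType) (lambda alpha : K).

Local Notation F := (free_alg K Ugen).

Definition Urels : seq F :=
  let g := gen K Ug in let gV := gen K UgV in
  let x := gen K Ux in let y := gen K Uy in
  [:: g * gV - 1;
      gV * g - 1;
      g * x * gV - x;
      g * y * gV - (y + x);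
      (y * x - x * y) - (- (2%:R^-1)%:K * x ^+ 2 + lambda%:K * (1 - g ^+ 2))].

Definition U := quot_alg (fun r : F => r \in Urels).
HB.instance Definition _ := PzAlgebra.on U.

Definition Uin (i : Ugen) : U := quot_pi _ (gen K i).

Definition Omega : U :=
  Uin Ux ^+ 2 * Uin UgV - (2%:R * lambda)%:K * (Uin UgV + Uin Ug).

Definition Ualpha := quot_alg (fun r : U => r = Omega - alpha%:K).
HB.instance Definition _ := PzAlgebra.on Ualpha.

Definition Ualpha_in (i : Ugen) : Ualpha := quot_pi _ (Uin i).

(* [s] stands for the chosen square root of [2 lambda] *)
Variable s : K.

Local Notation g := (Ualpha_in Ug).
Local Notation gV := (Ualpha_in UgV).
Local Notation x := (Ualpha_in Ux).
Local Notation y := (Ualpha_in Uy).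

Definition Uh : Ualpha := (s^-1)%:K * (y * gV).
Definition Ue : Ualpha := x - s%:K * g - (alpha / (2%:R * s))%:K.
Definition Uf : Ualpha := x + s%:K * g + (alpha / (2%:R * s))%:K.

Definition Bgens (a : Ualpha) : Prop := [\/ a = Uh, a = Ue | a = Uf].

Definition B := subalg Bgens.
HB.instance Definition _ := PzAlgebra.on B.

Definition Bval : B -> Ualpha := @subalg_val _ _ _.
Definition Bh : B := subalg_gen (Or31 _ _ erefl : Bgens Uh).
Definition Be : B := subalg_gen (Or32 _ _ erefl : Bgens Ue).
Definition Bf : B := subalg_gen (Or33 _ _ erefl : Bgens Uf).

Definition gtilde (A : pzAlgType K) (e : A) : A :=
  e ^+ 2 + (alpha / s)%:K * e
  + ((8%:R * lambda)^-1 * (alpha ^+ 2 - 16%:R * lambda ^+ 2))%:K.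

Definition gprime (A : pzAlgType K) (e f : A) : A :=
  e - f + (alpha / s)%:K.

End U.

(* Main.v *)
From HB Require Import structures.
From mathcomp Require Import all_boot all_order all_algebra.
From mathcomp Require Import boolp fraction.
From mathcomp Require Import -(notations) monalg.
From mathcomp Require Import mpoly.
From mathcomp Require Import ring.
Require Import Defs.

Set Implicit Arguments.
Unset Strict Implicit.
Unset Printing Implicit Defensive.

Import GRing.Theory.
Local Open Scope ring_scope.

(** Write w for s g + alpha / (2 s) and kappa for s^2 - (alpha / (2 s))^2, so
    that e = x - w and f = x + w.  Completing the square, the relation
    Omega = alpha becomes x^2 = w^2 + kappa, that is e f = kappa, and the other
    relations say that h acts by [h, x] = - w and [h, w] = - x, that is
    [h, e] = e and [h, f] = - f.  Conversely x, g and y = s h g are expressions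
    in h, e, f, and g is invertible.  So U^alpha is the Ore extension L[h; d']
    of the commutative ring L = A[g^-1], where A = K[e, f] / (e f - kappa)
    carries the derivation d with d e = e and d f = - f, and
    e - f + alpha / s = - 2 s g.  Multiplying out,
    4 s^2 kappa = (4 lambda - alpha) (4 lambda + alpha): when alpha is not
    +- 4 lambda, f is kappa e^-1, A is the ring of Laurent polynomials in e, and
    gtilde = e (e - f + alpha / s) is g up to a unit; otherwise A is the
    coordinate ring of a pair of crossing lines.

    Both cases are treated at once, through the interface [is_hyperbola] of A.
    All isomorphisms come from universal properties, and composites are
    identified on generators.  [Ualpha_ore] is the isomorphism of U^alpha with
    L[h; d'].  The ring A has enough morphisms to K(X) that do not kill the
    element to be inverted ([separated]); hence A embeds in L, therefore A[h; d]
    in L[h; d'], and the image of A[h; d] in U^alpha is the subalgebra generated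
    by h, e, f ([B_ore]).  Denominators can be cleared on both sides in
    L[h; d'] ([ore_left_frac], [ore_right_frac]), which identifies U^alpha with
    the localization of B ([loc_recognition]).

    When kappa is nonzero, L embeds in K(X), so leading coefficients make
    L[h; d'] a domain ([ore_domain]).  Commuting with e lowers the degree in h by
    one, so a nonzero ideal meets L, in a d'-stable ideal; such an ideal contains
    a nonzero polynomial in e, and differentiating it down to a constant shows
    that it contains 1 ([ore_simple], [laurent_loc_der_simple]).  When kappa is
    zero, e f = 0 with e and f nonzero, and e generates a proper two-sided ideal
    because h e = e (h + 1) ([ore_not_simple]). *)

(** * Scalars, inverses and commutators *)

Section Scalars.
Variables (K : fieldType) (C : pzAlgType K).

Lemma scalK (a : K) (x : C) : a != 0 -> (a^-1)%:K * (a%:K * x) = x.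
Proof. by move=> a0; rewrite mulrA -rmorphM mulVf // rmorph1 mul1r. Qed.

Lemma scalVK (a : K) (x : C) : a != 0 -> a%:K * ((a^-1)%:K * x) = x.
Proof. by move=> a0; rewrite mulrA -rmorphM divff // rmorph1 mul1r. Qed.

Lemma scal_comm (a : K) (x y : C) : x * (a%:K * y) = a%:K * (x * y).
Proof. by rewrite mulrA -scalC mulrA. Qed.

Hypothesis two_neq0 : 2%:R != 0 :> K.

Lemma scal2 (a : C) : a + a = (2%:R)%:K * a.
Proof. by rewrite rmorphD rmorph1 mulrDl mul1r. Qed.

Lemma half_sum (a b : C) :
  (2%:R^-1)%:K * ((a - b) + (a + b)) = a.
Proof. by rewrite addrACA addNr addr0 scal2 scalK. Qed.

Lemma half_diff (a b : C) :
  (2%:R^-1)%:K * ((a + b) - (a - b)) = b.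
Proof. by rewrite opprB addrC addrA subrK scal2 scalK. Qed.

End Scalars.

Lemma exprVK (R : pzRingType) (a b : R) n : a * b = 1 -> a ^+ n * b ^+ n = 1.
Proof.
move=> ab; elim: n => [|n IHn]; first by rewrite mulr1.
by rewrite exprSr exprS -mulrA [a * _]mulrA ab mul1r.
Qed.

Lemma commutatorM (R : pzRingType) (h a b : R) :
  h * (a * b) - (a * b) * h = (h * a - a * h) * b + a * (h * b - b * h).
Proof. by rewrite mulrBl mulrBr !mulrA addrA subrK. Qed.

(** * Universal properties and induction on generators *)

Section Morphisms.
Variable K : fieldType.

Definition alg_hom (A B : pzAlgType K) (phi : {rmorphism A -> B}) : Prop :=
  forall c : K, phi c%:K = c%:K.

Lemma rmorphism_of (A B : pzRingType) (f : A -> B) :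
  {morph f : a b / a + b} -> f 1 = 1 -> {morph f : a b / a * b} ->
  exists phi : {rmorphism A -> B}, phi =1 f.
Proof.
move=> fD f1 fM.
have fB : zmod_morphism f.
  by move=> a b; apply/eqP; rewrite eq_sym subr_eq -fD subrK.
have fR : monoid_morphism f by split.
by exists (HB.pack_for {rmorphism A -> B} f
  (GRing.isZmodMorphism.Build A B f fB)
  (GRing.isMonoidMorphism.Build A B f fR)).
Qed.

Lemma comp_hom (A B C : pzAlgType K) (psi : {rmorphism B -> C})
    (phi : {rmorphism A -> B}) : alg_hom psi -> alg_hom phi ->
  alg_hom (psi \o phi).
Proof. by move=> h1 h2 c /=; rewrite h2 h1. Qed.

Lemma alg_iso_inverse (A B : pzAlgType K) (phi : {rmorphism A -> B}) :
  alg_iso phi ->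
  exists psi : {rmorphism B -> A},
    [/\ alg_iso psi, cancel phi psi & cancel psi phi].
Proof.
move=> [hphi [g fK gK]].
have [psi psiE] : exists psi : {rmorphism B -> A}, psi =1 g.
  apply: rmorphism_of => [a b||a b]; apply: (can_inj fK).
  - by rewrite rmorphD !gK.
  - by rewrite gK rmorph1.
  - by rewrite rmorphM !gK.
have K1 : cancel phi psi by move=> a; rewrite psiE.
have K2 : cancel psi phi by move=> a; rewrite psiE.
exists psi; split=> //; split; last by exists phi.
by move=> c; rewrite -hphi K1.
Qed.

Section FreeAlgebra.
Variable I : choiceType.
Local Notation word := (monalg.fmonom I).

Lemma monomial_mul (c c' : K) (m m' : word) :
  (monalg.mkmalgU m c : free_alg K I) * monalg.mkmalgU m' c' =
  monalg.mkmalgU (monalg.mmul m m') (c * c').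
Proof. by rewrite free_mulE monalg.malgM_def monalg.fgmulUU. Qed.

(** Words are the products of their letters; this is what makes [free_ind] an
    induction on algebra generators. *)
Lemma monomialE (c : K) (m : word) :
  monalg.mkmalgU m c = c%:K * \prod_(i <- m) gen K i :> free_alg K I.
Proof.
case: m => w /=; elim: w c => [|i w IHw] c.
  by rewrite big_nil mulr1 {1}/scal /= free_scal.unlock /monalg.mone /= monalg.fmoneE.
rewrite big_cons mulrA scalC -mulrA -IHw gen.unlock monomial_mul mul1r.
congr (monalg.mkmalgU _ c).
by apply/eqP; rewrite monalg.fmP monalg.fmM monalg.fmU.
Qed.

Lemma free_ind (P : free_alg K I -> Prop) :
  (forall c, P c%:K) -> (forall i, P (gen K i)) ->
  (forall p q, P p -> P q -> P (p + q)) ->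
  (forall p q, P p -> P q -> P (p * q)) -> forall p, P p.
Proof.
move=> Pc Pg PD PM p.
have P0 : P 0 by rewrite -(rmorph0 (@scal K (free_alg K I))); apply: Pc.
have P1 : P 1 by rewrite -(rmorph1 (@scal K (free_alg K I))); apply: Pc.
rewrite [p]monalg.monalgE; apply: (big_ind P) => // m _.
rewrite monomialE; apply: (PM); first exact: Pc.
by apply: (big_ind P) => [|a b|i _]; [exact: P1|exact: PM|exact: Pg].
Qed.

Section Evaluation.
Import finmap.
Local Open Scope fset_scope.
Local Open Scope ring_scope.
Variables (C : pzAlgType K) (u : I -> C).

Definition free_eval (p : free_alg K I) : C :=
  \sum_(m <- monalg.msupp p) (monalg.mcoeff m p)%:K * \prod_(i <- m) u i.

Lemma free_evalEw (d : {fset word}) (p : free_alg K I) :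
  monalg.msupp p `<=` d ->
  free_eval p = \sum_(m <- d) (monalg.mcoeff m p)%:K * \prod_(i <- m) u i.
Proof.
move=> le; rewrite /free_eval (big_fset_incl _ le) //= => m _ mp.
by rewrite monalg.mcoeff_outdom // rmorph0 mul0r.
Qed.

Lemma free_evalD : {morph free_eval : p q / p + q}.
Proof.
move=> p q; pose d := monalg.msupp p `|` monalg.msupp q.
rewrite (@free_evalEw d) ?monalg.msuppD_le // (@free_evalEw d p) ?fsubsetUl //.
rewrite (@free_evalEw d q) ?fsubsetUr // -big_split /=.
by apply: eq_bigr => m _; rewrite monalg.mcoeffD rmorphD mulrDl.
Qed.

Lemma free_eval_monomial c m :
  free_eval (monalg.mkmalgU m c) = c%:K * \prod_(i <- m) u i.
Proof.
by rewrite (free_evalEw monalg.msuppU_le) big_seq_fset1 monalg.mcoeffUU.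
Qed.

Lemma free_evalM : {morph free_eval : p q / p * q}.
Proof.
have eval0 : free_eval 0 = 0.
  by apply: (addrI (free_eval 0)); rewrite -free_evalD !addr0.
move=> p q; rewrite [p]monalg.monalgE.
apply: (big_ind (fun p => free_eval (p * q) = free_eval p * free_eval q)).
- by rewrite mul0r eval0 mul0r.
- by move=> p1 p2 h1 h2; rewrite mulrDl !free_evalD mulrDl h1 h2.
move=> m _.
set w : free_alg K I := monalg.mkmalgU m _; rewrite [q]monalg.monalgE.
apply: (big_ind (fun q => free_eval (w * q) = free_eval w * free_eval q)).
- by rewrite mulr0 eval0 mulr0.
- by move=> q1 q2 h1 h2; rewrite mulrDr !free_evalD mulrDr h1 h2.
move=> m' _; rewrite monomial_mul !free_eval_monomial monalg.fmM big_cat /= rmorphM.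
by rewrite -!mulrA; congr (_ * _); rewrite !mulrA scalC.
Qed.

Lemma free_univ : exists phi : {rmorphism free_alg K I -> C},
  alg_hom phi /\ forall i, phi (gen K i) = u i.
Proof.
have evalc c : free_eval c%:K = c%:K.
  rewrite {1}/scal /= free_scal.unlock free_eval_monomial monalg.fm1.
  by rewrite big_nil mulr1.
have [|phi phiE] := rmorphism_of free_evalD _ free_evalM.
  by rewrite -(rmorph1 (@scal K _)) evalc rmorph1.
exists phi; split=> [c|i]; rewrite phiE ?evalc //.
by rewrite gen.unlock free_eval_monomial monalg.fmU big_seq1 rmorph1 mul1r.
Qed.

End Evaluation.
End FreeAlgebra.

Lemma quot_ind (A : pzAlgType K) (S : A -> Prop) (P : quot_alg S -> Prop) :
  (forall a, P (quot_pi S a)) -> forall q, P q.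
Proof. by move=> H q; rewrite -(quot_piK q). Qed.

Lemma quot_rel (A : pzAlgType K) (S : A -> Prop) a b :
  S (a - b) -> quot_pi S a = quot_pi S b.
Proof. by move=> Sab; apply/quot_piP/gen_ideal_gen. Qed.

(** The two-sided ideal generated by [S] lies in the kernel of any morphism that
    kills [S], so evaluating at a representative is well defined. *)
Lemma quot_univ (A C : pzAlgType K) (S : A -> Prop)
    (phi : {rmorphism A -> C}) :
  alg_hom phi -> (forall a, S a -> phi a = 0) ->
  exists psi : {rmorphism quot_alg S -> C},
    alg_hom psi /\ forall a, psi (quot_pi S a) = phi a.
Proof.
move=> hphi phiS.
have phiI a : gen_ideal S a -> phi a = 0.
  elim=> [|{}a /phiS //|{}a b _ h1 _ h2|{}a b _ h|{}a b _ h].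
  - exact: rmorph0.
  - by rewrite rmorphD h1 h2 addr0.
  - by rewrite rmorphM h mulr0.
  - by rewrite rmorphM h mul0r.
pose f (q : quot_alg S) := phi (generic_quotient.repr q).
have fE a : f (quot_pi S a) = phi a.
  by apply/eqP; rewrite -subr_eq0 -rmorphB; apply/eqP/phiI/quot_repr.
have [||| psi psiE] := @rmorphism_of (quot_alg S) C f.
- elim/quot_ind=> a; elim/quot_ind=> b.
  by rewrite -rmorphD !fE rmorphD.
- by rewrite -(rmorph1 (@quot_pi K A S)) fE rmorph1.
- elim/quot_ind=> a; elim/quot_ind=> b.
  by rewrite -rmorphM !fE rmorphM.
by exists psi; split=> [c|a]; rewrite psiE fE.
Qed.

Definition loc_inv (A : pzAlgType K) (s : A) : loc s :=
  quot_pi (@loc_rel K A s) (gen K None).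

Lemma loc_mulV (A : pzAlgType K) (s : A) : loc_in s s * loc_inv s = 1.
Proof.
by have := quot_rel (loc_rel_sV s); rewrite rmorphM rmorph1.
Qed.

Lemma loc_mulVr (A : pzAlgType K) (s : A) : loc_inv s * loc_in s s = 1.
Proof.
by have := quot_rel (loc_rel_Vs s); rewrite rmorphM rmorph1.
Qed.

Lemma loc_ind (A : pzAlgType K) (s : A) (P : loc s -> Prop) :
  (forall a, P (loc_in s a)) -> P (loc_inv s) ->
  (forall x y, P x -> P y -> P (x + y)) ->
  (forall x y, P x -> P y -> P (x * y)) -> forall x, P x.
Proof.
move=> Pa Pt PD PM; elim/quot_ind=> p; elim/free_ind: p => [c|[a|]|p q|p q].
- rewrite -[quot_pi _ _]/(c%:K : loc s) -loc_in_scal; exact: Pa.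
- exact: Pa.
- exact: Pt.
- by rewrite rmorphD; apply: PD.
- by rewrite rmorphM; apply: PM.
Qed.

(** The target may be noncommutative: the defining relations of the localization
    only mention sums and products of images and a two-sided inverse [t]. *)
Lemma loc_univ (A C : pzAlgType K) (s : A) (phi : {rmorphism A -> C}) (t : C) :
  alg_hom phi -> phi s * t = 1 -> t * phi s = 1 ->
  exists psi : {rmorphism loc s -> C},
    [/\ alg_hom psi, forall a, psi (loc_in s a) = phi a & psi (loc_inv s) = t].
Proof.
move=> hphi st ts.
have [ev [hev evE]] := free_univ (fun o => if o is Some a then phi a else t).
have [|psi [hpsi psiE]] := @quot_univ _ C (@loc_rel K A s) ev hev.
  move=> _ [a b|a b|c||]; rewrite !rmorphB ?rmorphD ?rmorphM ?rmorph1 !evE ?hev.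
  - by rewrite rmorphD subrr.
  - by rewrite rmorphM subrr.
  - by rewrite hphi subrr.
  - by rewrite st subrr.
  - by rewrite ts subrr.
by exists psi; split=> // [a|]; rewrite psiE evE.
Qed.

(** Polynomial evaluation in a possibly noncommutative, possibly zero ring, at an
    element that commutes with the coefficients.  Applied twice, it also evaluates
    polynomials in two commuting variables. *)
Lemma poly_univ (R : nzRingType) (C : pzRingType) (phi : {rmorphism R -> C})
    (c : C) : (forall a, phi a * c = c * phi a) ->
  exists psi : {rmorphism {poly R} -> C},
    (forall a, psi a%:P = phi a) /\ psi 'X = c.
Proof.
move=> cC; pose f (p : {poly R}) := \sum_(i < size p) phi p`_i * c ^+ i.
have fEw n (p : {poly R}) : (size p <= n)%N ->
    f p = \sum_(i < n) phi p`_i * c ^+ i.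
  move=> le; rewrite /f (big_ord_widen n (fun i => phi p`_i * c ^+ i)) //.
  rewrite big_mkcond; apply: eq_bigr => i _; case: ifP => // /negbT.
  by rewrite -leqNgt => /(nth_default 0) ->; rewrite rmorph0 mul0r.
have fD : {morph f : p q / p + q}.
  move=> p q; pose n := maxn (size p) (size q).
  rewrite (@fEw n) ?size_polyD // (@fEw n p) ?leq_maxl //.
  rewrite (@fEw n q) ?leq_maxr // -big_split /=.
  by apply: eq_bigr => i _; rewrite coefD rmorphD mulrDl.
have fC a : f a%:P = phi a.
  by rewrite (@fEw 1) ?size_polyC_leq1 // big_ord1 coefC mulr1.
have fMX p : f (p * 'X) = f p * c.
  rewrite (@fEw (size p).+1); last first.
    by have [->|/size_mulX ->] := eqVneq p 0; rewrite ?mul0r ?size_poly0.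
  rewrite big_ord_recl coefMX rmorph0 mul0r add0r /f mulr_suml.
  by apply: eq_bigr => i _; rewrite coefMX exprSr mulrA.
have fCM a p : f (a%:P * p) = phi a * f p.
  rewrite mul_polyC (@fEw (size p)) ?size_scale_leq // /f mulr_sumr.
  by apply: eq_bigr => i _; rewrite coefZ rmorphM mulrA.
have cf p : f p * c = c * f p.
  elim/poly_ind: p => [|p a IHp].
    by rewrite -(raddf0 polyC) fC cC.
  by rewrite fD fC fMX mulrDl mulrDr cC IHp -mulrA IHp.
have fM : {morph f : p q / p * q}.
  move=> p q; elim/poly_ind: p => [|p a IHp].
    by rewrite mul0r -(raddf0 polyC) fC rmorph0 mul0r.
  rewrite mulrDl fD fCM fD fC fMX mulrDl -mulrA -commr_polyX mulrA fMX IHp.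
  by rewrite -!mulrA cf.
have [|psi psiE] := rmorphism_of fD _ fM; first by rewrite fC rmorph1.
exists psi; split=> [a|]; rewrite psiE ?fC //.
by rewrite -['X]mul1r fMX -polyC1 fC rmorph1 mul1r.
Qed.

Lemma corestrict (R : pzAlgType K) (C : pzAlgType K) (S : C -> Prop)
    (th : {rmorphism R -> C}) : alg_hom th -> (forall r, gen_subalg S (th r)) ->
  exists th' : {rmorphism R -> subalg S},
    alg_hom th' /\ forall r, subalg_val (th' r) = th r.
Proof.
move=> hth thS; pose g r : subalg S := Subalg (introT (subalg_predP S _) (thS r)).
have [|||th' thE] := @rmorphism_of _ _ g.
- by move=> a b; apply: val_inj; rewrite /= rmorphD.
- by apply: val_inj; rewrite /= rmorph1.
- by move=> a b; apply: val_inj; rewrite /= rmorphM.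
exists th'; split=> [k|r]; rewrite thE //.
by apply: val_inj; rewrite /= hth.
Qed.

Section OreExtension.
Variables (A C : pzAlgType K) (d : derivation A).

Lemma ore_ind_mul (P : ore_ext d -> Prop) :
  (forall a, P (ore_in d a)) -> P (ore_h d) ->
  (forall p q, P p -> P q -> P (p + q)) ->
  (forall p q, P p -> P q -> P (p * q)) -> forall p, P p.
Proof.
move=> Pa Ph PD PM; elim/ore_ind => // a n.
rewrite ore_termE; apply: (PM); first exact: Pa.
elim: n => [|n IHn].
  by rewrite expr0 -(rmorph1 (ore_in d)); apply: Pa.
by rewrite exprS; apply: PM.
Qed.

(** Monomials [a h^n] go to [phi a * H ^+ n]; the commutation rule of [H] mirrors
    the definition of left multiplication by [h], which is all that the product
    of the Ore extension is made of. *)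
Lemma ore_univ (phi : {rmorphism A -> C}) (H : C) :
  alg_hom phi -> (forall a, H * phi a - phi a * H = phi (d a)) ->
  exists psi : {rmorphism ore_ext d -> C},
    [/\ alg_hom psi, forall a, psi (ore_in d a) = phi a & psi (ore_h d) = H].
Proof.
move=> hphi HC; pose f : ore_ext d -> C := mext (fun n a => phi a * H ^+ n).
have FD n : {morph (fun a => phi a * H ^+ n) : a b / a + b}.
  by move=> a b; rewrite rmorphD mulrDl.
have fD : {morph f : p q / p + q} by apply: mextD FD.
have fT a n : f (ore_term d a n) = phi a * H ^+ n.
  by rewrite ore_termU; apply: mextU FD _ _.
have fl a q : f (ore_lmul a q) = phi a * f q.
  elim/ore_ind: q => [b n|p q h1 h2].
    by rewrite ore_lmul_term !fT rmorphM mulrA.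
  by rewrite ore_lmulD !fD mulrDr h1 h2.
have fh q : f (ore_hmul q) = H * f q.
  elim/ore_ind: q => [b n|p q h1 h2].
    rewrite ore_hmul_term fD !fT -HC mulrBl exprS !mulrA addrC.
    by rewrite subrK.
  by rewrite ore_hmulD !fD mulrDr h1 h2.
have fM : {morph f : p q / p * q}.
  move=> p q; elim/ore_ind: p => [a n|p p' h1 h2].
    rewrite {1}/GRing.mul /= ore_mul_term fl fT -mulrA; congr (_ * _).
    by elim: n => [|n IHn]; rewrite ?mul1r //= fh IHn exprS mulrA.
  by rewrite mulrDl !fD mulrDl h1 h2.
have [|psi psiE] := rmorphism_of fD _ fM.
  have -> : 1 = ore_term d 1 0 by [].
  by rewrite fT rmorph1 mulr1.
exists psi; split=> [c|a|]; rewrite psiE.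
- have -> : c%:K = ore_term d c%:K 0 by [].
  by rewrite fT hphi mulr1.
- by rewrite fT mulr1.
- by rewrite fT rmorph1 mul1r expr1.
Qed.

End OreExtension.

End Morphisms.

(** * Extending derivations to localizations and quotients *)

Section DualNumbers.
Variables (K : fieldType) (A : pzAlgType K).

(** The dual numbers [A[eps]], with [eps ^ 2 = 0].  A derivation [d] amounts to the
    ring morphism [a |-> a + d a eps]; through it, the universal property of the
    localization extends derivations although its elements have no canonical form
    as fractions. *)
Definition dual := (A * A)%type.
HB.instance Definition _ := GRing.Zmodule.on dual.

Definition dual_mul (p q : dual) : dual := (p.1 * q.1, p.2 * q.1 + p.1 * q.2).
Definition dual_one : dual := (1, 0).

Lemma dual_mulA : associative dual_mul.
Proof.
move=> p q r; rewrite /dual_mul /= mulrA; congr pair.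
by rewrite mulrDl mulrDr !mulrA addrA.
Qed.

Lemma dual_mul1p : left_id dual_one dual_mul.
Proof. by case=> a b; rewrite /dual_mul /= !mul1r mul0r add0r. Qed.

Lemma dual_mulp1 : right_id dual_one dual_mul.
Proof. by case=> a b; rewrite /dual_mul /= !mulr1 mulr0 addr0. Qed.

Lemma dual_mulDl : left_distributive dual_mul +%R.
Proof.
move=> p q r; rewrite /dual_mul /= mulrDl; congr pair.
by rewrite !mulrDl /= addrACA.
Qed.

Lemma dual_mulDr : right_distributive dual_mul +%R.
Proof.
move=> p q r; rewrite /dual_mul /= mulrDr; congr pair.
by rewrite !mulrDr /= addrACA.
Qed.

HB.instance Definition _ := GRing.Zmodule_isPzRing.Build dual
  dual_mulA dual_mul1p dual_mulp1 dual_mulDl dual_mulDr.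

Definition dual_scal (c : K) : dual := (c%:K, 0).

Lemma dual_scal_zmod : zmod_morphism dual_scal.
Proof. by move=> c c'; apply/pair_equal_spec; rewrite /= rmorphB subr0. Qed.

Lemma dual_scal_monoid : monoid_morphism dual_scal.
Proof.
split=> [|c c']; apply/pair_equal_spec; first by rewrite rmorph1.
by rewrite /= rmorphM mul0r mulr0 addr0.
Qed.

Lemma dual_scalC c p : dual_scal c * p = p * dual_scal c.
Proof.
apply/pair_equal_spec; split=> /=; first exact: scalC.
by rewrite mul0r mulr0 add0r addr0 scalC.
Qed.

HB.instance Definition _ := isPzAlgebra.Build K dual
  dual_scal_zmod dual_scal_monoid dual_scalC.

End DualNumbers.

Section Derivations.
Variable K : fieldType.

Lemma der_inv (A : pzAlgType K) (d : derivation A) (s t : A) :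
  s * t = 1 -> t * s = 1 -> d t = - (t * d s * t).
Proof.
move=> st ts; apply/eqP; rewrite -addr_eq0; apply/eqP.
have := derM d s t; rewrite st der1 => /(congr1 ( *%R t)).
by rewrite mulr0 mulrDr !mulrA ts mul1r addrC => <-.
Qed.

Lemma loc_der_eq (A : pzAlgType K) (s : A) (d1 d2 : derivation (loc s)) :
  (forall a, d1 (loc_in s a) = d2 (loc_in s a)) -> d1 =1 d2.
Proof.
move=> h; elim/loc_ind=> [//||x y h1 h2|x y h1 h2].
- by rewrite !(der_inv _ (loc_mulV s) (loc_mulVr s)) h.
- by rewrite !derD h1 h2.
- by rewrite !derM h1 h2.
Qed.

(** The quotient rule [d (s^-1) = - s^-1 d(s) s^-1] is exactly the condition that
    [s + d s eps] be invertible in the dual numbers with inverse over [s^-1]. *)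
Lemma loc_derivation (A : pzAlgType K) (s : A) (d : derivation A) :
  exists d' : derivation (loc s), determined_by (der_extends (loc_in s) d) d'.
Proof.
pose f (a : A) : dual (loc s) := (loc_in s a, loc_in s (d a)).
have [||| phi phiE] := @rmorphism_of A (dual (loc s)) f.
- by move=> a b; rewrite /f derD !rmorphD.
- by rewrite /f der1 rmorph1 rmorph0.
- move=> a b; rewrite /f derM rmorphD !rmorphM; congr pair.
pose t := loc_inv s; pose ds := loc_in s (d s).
have hphi : alg_hom phi.
  by move=> c; rewrite phiE /f der_scal loc_in_scal rmorph0.
have [||psi [hpsi psia psit]] :=
    @loc_univ K A (dual (loc s)) s phi (t, - (t * ds * t)) hphi.
- rewrite phiE /f; congr pair; rewrite /= ?loc_mulV // mulrN !mulrA loc_mulV.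
  by rewrite mul1r subrr.
- rewrite phiE /f; congr pair; rewrite /= ?loc_mulVr // mulNr -!mulrA loc_mulVr.
  by rewrite mulr1 addNr.
have psi1 x : (psi x).1 = x.
  elim/loc_ind: x => [a||x y h1 h2|x y h1 h2].
  - by rewrite psia phiE.
  - by rewrite psit.
  - by rewrite rmorphD /= h1 h2.
  - by rewrite rmorphM /= h1 h2.
have dD : {morph (fun x => (psi x).2) : x y / x + y}.
  by move=> x y; rewrite rmorphD.
have dM x y : (psi (x * y)).2 = (psi x).2 * y + x * (psi y).2.
  by rewrite rmorphM /= !psi1.
have dc (c : K) : (psi c%:K).2 = 0 by rewrite hpsi.
exists (Derivation dD dM dc); split=> [a|d' hd'].
  by rewrite /= psia phiE.
by apply: loc_der_eq => a /=; rewrite hd' psia phiE.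
Qed.

Lemma quot_derivation (A : pzAlgType K) (S : A -> Prop) (d : derivation A) :
  (forall a, S a -> gen_ideal S (d a)) ->
  exists d' : derivation (quot_alg S), forall a,
    d' (quot_pi S a) = quot_pi S (d a).
Proof.
move=> dS.
have dI a : gen_ideal S a -> gen_ideal S (d a).
  elim=> [|{}a /dS //|{}a b _ h1 _ h2|{}a b hb h|{}a b hb h].
  - by rewrite der0; apply: gen_ideal0.
  - by rewrite derD; apply: gen_idealD.
  - by rewrite derM; apply: gen_idealD; apply: gen_idealMl.
  - by rewrite derM; apply: gen_idealD; apply: gen_idealMr.
pose f (q : quot_alg S) := quot_pi S (d (generic_quotient.repr q)).
have dB a b : d (a - b) = d a - d b.
  by apply: (addIr (d b)); rewrite -derD !subrK.
have fE a : f (quot_pi S a) = quot_pi S (d a).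
  by apply/quot_piP; rewrite -dB; apply/dI/quot_repr.
have fD : {morph f : p q / p + q}.
  elim/quot_ind=> a; elim/quot_ind=> b.
  by rewrite -rmorphD !fE derD rmorphD.
have fM p q : f (p * q) = f p * q + p * f q.
  elim/quot_ind: p => a; elim/quot_ind: q => b.
  by rewrite -rmorphM !fE derM rmorphD !rmorphM.
have fc (c : K) : f c%:K = 0.
  by rewrite [LHS]fE der_scal rmorph0.
by exists (Derivation fD fM fc) => a /=; apply: fE.
Qed.

End Derivations.

(** * The field of rational functions as an algebra *)

Section FractionField.
Variable K : fieldType.
Local Notation F := {fraction {poly K}}.

Lemma fraction_scal_monoid :
  monoid_morphism (fun c : K => tofrac c%:P : F).
Proof. by split=> [|c c']; rewrite ?rmorph1 ?rmorphM. Qed.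
Lemma fraction_scal_zmod :
  zmod_morphism (fun c : K => tofrac c%:P : F).
Proof. by move=> c c'; rewrite !rmorphB. Qed.
HB.instance Definition _ :=
  isPzAlgebra.Build K F fraction_scal_zmod fraction_scal_monoid
    (fun c p => mulrC _ p).

End FractionField.

(** * The presentation of U^alpha *)

Section Presentation.
Variables (K : fieldType) (lambda alpha : K).

Lemma U_ind (P : U lambda -> Prop) :
  (forall c, P c%:K) -> (forall i, P (Uin lambda i)) ->
  (forall p q, P p -> P q -> P (p + q)) ->
  (forall p q, P p -> P q -> P (p * q)) -> forall p, P p.
Proof.
move=> Pc Pg PD PM; elim/quot_ind=> p.
elim/free_ind: p => [c|i|p q|p q].
- exact: Pc.
- exact: Pg.
- by rewrite rmorphD; apply: PD.
- by rewrite rmorphM; apply: PM.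
Qed.

Local Notation Ua := (Ualpha lambda alpha).
Local Notation in_ := (Ualpha_in lambda alpha).

Lemma Ualpha_ind (P : Ua -> Prop) :
  (forall c, P c%:K) -> (forall i, P (in_ i)) ->
  (forall p q, P p -> P q -> P (p + q)) ->
  (forall p q, P p -> P q -> P (p * q)) -> forall p, P p.
Proof.
move=> Pc Pg PD PM; elim/quot_ind=> p.
elim/U_ind: p => [c|i|p q|p q].
- exact: Pc.
- exact: Pg.
- by rewrite rmorphD; apply: PD.
- by rewrite rmorphM; apply: PM.
Qed.

(** The defining relations with [gV] cleared from all but the first: conjugation
    by [g] is written as a commutation rule, and [Omega = alpha] is multiplied
    by [g]. *)
Definition Urelations (C : pzAlgType K) (g gV x y : C) : Prop :=
  [/\ g * gV = 1 /\ gV * g = 1,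
      g * x = x * g,
      g * y = (y + x) * g,
      y * x - x * y =
        - (2%:R^-1)%:K * x ^+ 2 + lambda%:K * (1 - g ^+ 2)
    & x ^+ 2 = (2%:R * lambda)%:K * (1 + g ^+ 2) + alpha%:K * g].

Lemma Urelations_intro (C : pzAlgType K) (g gV x y : C) :
  g * gV = 1 -> gV * g = 1 -> g * x * gV = x -> g * y * gV = y + x ->
  y * x - x * y = - (2%:R^-1)%:K * x ^+ 2 + lambda%:K * (1 - g ^+ 2) ->
  x ^+ 2 * gV - (2%:R * lambda)%:K * (gV + g) = alpha%:K ->
  Urelations g gV x y.
Proof.
move=> ggV gVg gx gy yx xx; split=> //.
- by rewrite -{2}gx -(mulrA (g * x)) gVg mulr1.
- by rewrite -gy -(mulrA (g * y)) gVg mulr1.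
have {}xx : x ^+ 2 * gV = (2%:R * lambda)%:K * (gV + g) + alpha%:K.
  by rewrite -xx addrC subrK.
by rewrite -[LHS]mulr1 -gVg mulrA xx mulrDl -mulrA [(gV + g) * g]mulrDl gVg.
Qed.

Lemma Ualpha_relations : Urelations (in_ Ug) (in_ UgV) (in_ Ux) (in_ Uy).
Proof.
pose pi : {rmorphism U lambda -> Ua} := quot_pi _.
pose rho : {rmorphism free_alg K Ugen -> U lambda} := quot_pi _.
have rel k : (k < 5)%N -> pi (rho (Urels lambda)`_k) = 0.
  move=> hk; rewrite -(rmorph0 pi) -(rmorph0 rho); congr (pi _).
  by apply: quot_rel; rewrite subr0; apply: mem_nth.
have r6 : pi (Omega lambda - alpha%:K) = 0.
  by rewrite -(rmorph0 pi); apply: quot_rel; rewrite subr0.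
move: (rel 0 isT) (rel 1 isT) (rel 2 isT) (rel 3 isT) (rel 4 isT) r6 => {rel} /=.
have hpi c : pi c%:K = c%:K by [].
have hrho c : rho c%:K = c%:K by [].
have inE i : pi (rho (gen K i)) = in_ i by [].
have UinE i : pi (Uin lambda i) = in_ i by [].
rewrite /Omega !(rmorphXn rho, rmorphB rho, rmorphD rho, rmorphM rho,
  rmorph1 rho, rmorphN rho, hrho).
rewrite !(rmorphXn pi, rmorphB pi, rmorphD pi, rmorphM pi, rmorph1 pi,
  rmorphN pi, hpi, inE, UinE).
by do 6![move=> /subr0_eq ?]; apply: Urelations_intro.
Qed.

Lemma Ualpha_univ (C : pzAlgType K) (g gV x y : C) :
  Urelations g gV x y ->
  exists phi : {rmorphism Ua -> C}, [/\ alg_hom phi,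
    phi (in_ Ug) = g, phi (in_ UgV) = gV, phi (in_ Ux) = x & phi (in_ Uy) = y].
Proof.
move=> [[ggV gVg] gx gy yx xx].
have [ev [hev evE]] := free_univ (fun i => match i with
  | Ug => g | UgV => gV | Ux => x | Uy => y end).
have [|ev1 [hev1 ev1E]] := @quot_univ _ _ _ (fun r => r \in Urels lambda) ev hev.
  move=> r; rewrite !inE => /or4P[| | |/orP[]] /eqP ->;
    rewrite !(rmorphXn ev, rmorphB ev, rmorphD ev, rmorphM ev, rmorph1 ev,
      rmorphN ev, hev, evE).
  - by rewrite ggV subrr.
  - by rewrite gVg subrr.
  - by rewrite gx -mulrA ggV mulr1 subrr.
  - by rewrite gy -mulrA ggV mulr1 subrr.
  - by rewrite yx subrr.
have ev1in i : ev1 (Uin lambda i) = match i with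
  | Ug => g | UgV => gV | Ux => x | Uy => y end by rewrite ev1E evE.
have [|phi [hphi phiE]] :=
    @quot_univ _ _ _ (fun r => r = Omega lambda - alpha%:K) ev1 hev1.
  move=> _ ->; rewrite /Omega.
  rewrite !(rmorphXn ev1, rmorphB ev1, rmorphD ev1, rmorphM ev1, hev1, ev1in).
  have -> : x ^+ 2 * gV = (2%:R * lambda)%:K * (gV + g) + alpha%:K.
    rewrite xx [LHS]mulrDl -!mulrA ggV mulr1 [(1 + _) * _]mulrDl mul1r expr2.
    by rewrite -mulrA ggV mulr1.
  by rewrite [X in X - _ - _]addrC addrK subrr.
by exists phi; split=> //; rewrite phiE ev1in.
Qed.

End Presentation.

(** * From the generators g, x, y to h, e, f *)

Section ChangeOfGenerators.
Variables (K : fieldType) (lambda alpha s c : K).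
Hypothesis two_neq0 : 2%:R != 0 :> K.
Hypothesis s_neq0 : s != 0.
Hypothesis s_sqrt : s ^+ 2 = 2%:R * lambda.
Hypothesis alphaE : alpha = 2%:R * s * c.
Variable C : pzAlgType K.
Implicit Types g gV x y h w : C.

(** An identity between polynomials in the single element [g], so it may be checked
    in the commutative ring [{poly K}] and evaluated. *)
Lemma complete_square g :
  (s%:K * g + c%:K) ^+ 2 + (s ^+ 2 - c ^+ 2)%:K =
  (2%:R * lambda)%:K * (1 + g ^+ 2) + alpha%:K * g.
Proof.
have [ev [evC evX]] := poly_univ (fun a => scalC a g).
have /(congr1 ev) : (s%:P * 'X + c%:P) ^+ 2 + (s ^+ 2 - c ^+ 2)%:P =
  (s ^+ 2)%:P * (1 + 'X ^+ 2) + (2%:R * s * c)%:P * 'X by ring.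
rewrite -alphaE -s_sqrt.
by rewrite !(rmorphXn ev, rmorphD ev, rmorphM ev, rmorph1 ev, evC, evX).
Qed.

(** Modulo [Omega = alpha], the commutator [y x - x y] is a multiple of [g]; this is
    why dividing [y] by [g] gives an element [h] that acts linearly. *)
Lemma half_square g x :
  x ^+ 2 = (2%:R * lambda)%:K * (1 + g ^+ 2) + alpha%:K * g ->
  - (2%:R^-1)%:K * x ^+ 2 + lambda%:K * (1 - g ^+ 2) =
  - (s%:K * (s%:K * g + c%:K) * g).
Proof.
move=> ->; have [ev [evC evX]] := poly_univ (fun a => scalC a g).
have /(congr1 ev) : - (2%:R^-1)%:P * ((2%:R * lambda)%:P * (1 + 'X ^+ 2)
    + alpha%:P * 'X) + lambda%:P * (1 - 'X ^+ 2) =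
  - (s%:P * (s%:P * 'X + c%:P) * 'X).
  rewrite mulNr mulrDr !mulrA -!polyCM mulKf // alphaE -!mulrA mulKf //.
  have hs : s%:P ^+ 2 = 2%:R * lambda%:P :> {poly K}.
    by rewrite -polyC_exp s_sqrt polyCM polyC_natr.
  by ring: hs.
by rewrite !(rmorphXn ev, rmorphB ev, rmorphN ev, rmorphD ev, rmorphM ev,
  rmorph1 ev, evC, evX).
Qed.

Lemma commutator_affine h g :
  h * (s%:K * g + c%:K) - (s%:K * g + c%:K) * h = s%:K * (h * g - g * h).
Proof.
by rewrite mulrDl mulrDr -(scalC c h) opprD addrACA subrr addr0 scal_comm -mulrA mulrBr.
Qed.

(** In the coordinates [x], [w] the relations become those of a hyperbola
    [x^2 - w^2 = kappa] on which [h] acts by an infinitesimal hyperbolic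
    rotation. *)
Lemma Urelations_hyperbolic g gV x y (w := s%:K * g + c%:K)
    (h := (s^-1)%:K * (y * gV)) :
  Urelations lambda alpha g gV x y ->
  [/\ w * x = x * w, x ^+ 2 = w ^+ 2 + (s ^+ 2 - c ^+ 2)%:K,
      h * w - w * h = - x & h * x - x * h = - w].
Proof.
case=> [[ggV gVg] gx gy yx xx].
have gVx : gV * x = x * gV.
  by rewrite -[LHS]mulr1 -ggV -!mulrA [x * (g * gV)]mulrA -gx !mulrA gVg mul1r.
split.
- by rewrite mulrDl mulrDr -mulrA gx scal_comm [c%:K * x]scalC.
- by rewrite complete_square.
- rewrite commutator_affine -mulrA -[y * gV * g]mulrA gVg mulr1 scal_comm.
  rewrite [g * (y * gV)]mulrA.
  rewrite gy -mulrA ggV mulr1 -mulrBr scalVK //.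
  by rewrite opprD addrA subrr add0r.
- rewrite scal_comm -!mulrA -mulrBr gVx !mulrA -mulrBl yx half_square // mulNr.
  by rewrite -!mulrA ggV mulr1 mulrN scalK.
Qed.

Lemma hyperbolic_Urelations g gV x h (w := s%:K * g + c%:K) :
  g * gV = 1 -> gV * g = 1 ->
  w * x = x * w -> x ^+ 2 = w ^+ 2 + (s ^+ 2 - c ^+ 2)%:K ->
  h * w - w * h = - x -> h * x - x * h = - w ->
  Urelations lambda alpha g gV x (s%:K * (h * g)).
Proof.
move=> ggV gVg wx xx hw hx.
have xE : x ^+ 2 = (2%:R * lambda)%:K * (1 + g ^+ 2) + alpha%:K * g.
  by rewrite xx complete_square.
have gx : g * x = x * g.
  move: wx; rewrite mulrDl mulrDr [c%:K * x]scalC => /addIr.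
  by rewrite -mulrA scal_comm => /(congr1 ( *%R (s^-1)%:K)); rewrite !scalK.
have gh : s%:K * (g * h) = s%:K * (h * g) + x.
  apply/eqP; rewrite addrC -subr_eq -mulrBr -opprB mulrN -commutator_affine.
  by rewrite hw opprK.
split=> //.
- by rewrite scal_comm mulrA -[RHS]/((s%:K * (h * g) + x) * g) -gh !mulrA.
- rewrite half_square // scal_comm -!mulrA -mulrBr gx !mulrA -mulrBl hx.
  by rewrite mulNr mulrN !mulrA.
Qed.

(** The light-cone coordinates [x - w], [x + w] diagonalize the action of [h]. *)
Lemma hyperbola x w h (e := x - w) (f := x + w) :
  w * x = x * w -> x ^+ 2 = w ^+ 2 + (s ^+ 2 - c ^+ 2)%:K ->
  h * w - w * h = - x -> h * x - x * h = - w ->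
  [/\ e * f = (s ^+ 2 - c ^+ 2)%:K, f * e = (s ^+ 2 - c ^+ 2)%:K,
      h * e - e * h = e & h * f - f * h = - f].
Proof.
move=> wx xx hw hx; have xxE : x ^+ 2 - w ^+ 2 = (s ^+ 2 - c ^+ 2)%:K.
  by rewrite xx addrAC subrr add0r.
split; rewrite -?xxE.
- by rewrite mulrDr !mulrBl -wx -!expr2 addrA subrK.
- by rewrite mulrBr !mulrDl -wx -!expr2 opprD addrA addrK.
- rewrite mulrBr mulrBl opprD addrACA hx -opprD hw.
  by rewrite opprK addrC.
- by rewrite mulrDr mulrDl opprD addrACA hx hw -opprD addrC.
Qed.
End ChangeOfGenerators.

(** * Localizations of commutative algebras *)

Section CommutativeLocalization.
Variables (K : fieldType) (A : pzAlgType K) (s : A).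
Hypothesis mulA_comm : forall a b : A, a * b = b * a.

Lemma loc_in_comm a (x : loc s) : loc_in s a * x = x * loc_in s a.
Proof.
elim/loc_ind: x => [b||x y hx hy|x y hx hy].
- by rewrite -!rmorphM mulA_comm.
- rewrite -[LHS]mul1r -{1}(loc_mulVr s) -mulrA [loc_in s s * _]mulrA -rmorphM.
  by rewrite mulA_comm rmorphM -mulrA loc_mulV mulr1.
- by rewrite mulrDr mulrDl hx hy.
- by rewrite mulrA hx -mulrA hy mulrA.
Qed.

Lemma loc_comm (x y : loc s) : x * y = y * x.
Proof.
elim/loc_ind: x => [a||x z hx hz|x z hx hz].
- exact: loc_in_comm.
- rewrite -[LHS]mulr1 -{1}(loc_mulV s) mulrA -[_ * y * _]mulrA -loc_in_comm.
  by rewrite [_ * (_ * y)]mulrA loc_mulVr mul1r.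
- by rewrite mulrDr mulrDl hx hz.
- by rewrite -mulrA hz mulrA hx mulrA.
Qed.

Lemma loc_num (x : loc s) : exists a n, x * loc_in s s ^+ n = loc_in s a.
Proof.
elim/loc_ind: x => [a||x y [a [n ha]] [b [m hb]]|x y [a [n ha]] [b [m hb]]].
- by exists a, 0%N; rewrite mulr1.
- by exists 1, 1%N; rewrite loc_mulVr rmorph1.
- exists (a * s ^+ m + b * s ^+ n), (n + m)%N.
  by rewrite mulrDl {1}exprD addnC exprD !mulrA ha hb rmorphD !rmorphM !rmorphXn.
- exists (a * b), (n + m)%N.
  by rewrite exprD mulrA -[x * y * _]mulrA [y * _]loc_comm mulrA ha -mulrA hb rmorphM.
Qed.

Lemma loc_num0 (x : loc s) n : x * loc_in s s ^+ n = 0 -> x = 0.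
Proof. by move=> h; rewrite -[x]mulr1 -(exprVK n (loc_mulV s)) mulrA h mul0r. Qed.

End CommutativeLocalization.

(** * The algebras K[e, f] / (e f - kappa) *)

Section Hyperbola.
Variable K : fieldType.
Local Notation F := {fraction {poly K}}.

(** The common interface of Laurent polynomials ([kappa != 0]) and of the two
    crossing lines ([kappa = 0]).  The universal property ranges over
    noncommutative targets because [A] is to be mapped into U^alpha. *)
Record is_hyperbola (A : pzAlgType K) (e f : A) (kappa : K) : Prop := {
  hyp_comm : forall a b : A, a * b = b * a;
  hyp_rel : e * f = kappa%:K;
  hyp_ind : forall P : A -> Prop, (forall c, P c%:K) -> P e -> P f ->
    (forall a b, P a -> P b -> P (a + b)) ->
    (forall a b, P a -> P b -> P (a * b)) -> forall a, P a;
  hyp_univ : forall (C : pzAlgType K) (e' f' : C),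
    e' * f' = kappa%:K -> f' * e' = kappa%:K ->
    exists phi : {rmorphism A -> C},
      [/\ alg_hom phi, phi e = e' & phi f = f']
}.

(** Points of [A] with values in [K(X)] at which [a0] does not vanish detect all
    elements of [A].  Each such point extends to the localization at [a0], so this
    yields the injectivity of [A -> A[a0^-1]] without any description of when a
    fraction is zero. *)
Definition separated (A : pzAlgType K) (a0 : A) : Prop :=
  forall a, (forall phi : {rmorphism A -> F},
    alg_hom phi -> phi a0 != 0 -> phi a = 0) -> a = 0.

Lemma hyp_der_eq (A : pzAlgType K) (e f : A) kappa (d1 d2 : derivation A) :
  is_hyperbola e f kappa -> d1 e = d2 e -> d1 f = d2 f -> d1 =1 d2.
Proof.
move=> hyp he hf; apply: (hyp_ind hyp) => // [c|a b h1 h2|a b h1 h2].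
- by rewrite !der_scal.
- by rewrite !derD h1 h2.
- by rewrite !derM h1 h2.
Qed.

Lemma separated_loc_inj (A : pzAlgType K) (s : A) :
  separated s -> injective (loc_in s).
Proof.
move=> sep; apply: raddf_inj => a ha; apply: sep => phi hphi phis.
have [||psi [_ psiE _]] := @loc_univ K A F s phi (phi s)^-1 hphi.
- by rewrite divff.
- by rewrite mulVf.
by rewrite -psiE ha rmorph0.
Qed.

End Hyperbola.

Section Laurent.
Variable K : fieldType.
Local Notation F := {fraction {poly K}}.
Local Notation L := (laurent K).
Local Notation lin := (loc_in ('X : {poly K})).
Local Notation e := (laurent_e K).

Lemma poly_hom_ind (P : {poly K} -> Prop) :
  (forall c, P c%:P) -> P 'X -> (forall p q, P p -> P q -> P (p + q)) ->
  (forall p q, P p -> P q -> P (p * q)) -> forall p, P p.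
Proof.
move=> Pc PX PD PM; elim/poly_ind => [|p c IHp].
  by rewrite -(raddf0 polyC); apply: Pc.
by apply: (PD); [apply: PM|apply: Pc].
Qed.

Lemma laurent_comm (a b : L) : a * b = b * a.
Proof. exact/loc_comm/mulrC. Qed.

Definition laurent_f (kappa : K) : L := kappa%:K * loc_inv ('X : {poly K}).

Lemma laurent_hyperbola kappa : kappa != 0 ->
  is_hyperbola e (laurent_f kappa) kappa.
Proof.
move=> k0; split=> [|||C e' f' ef fe].
- exact: laurent_comm.
- by rewrite /laurent_f mulrA -scalC -mulrA loc_mulV mulr1.
- move=> P Pc Pe Pf PD PM; elim/loc_ind=> [p||a b|a b].
  + elim/poly_hom_ind: p => [c||p q|p q].
    * by rewrite -[c%:P]/(c%:K : {poly K}) loc_in_scal; apply: Pc.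
    * exact: Pe.
    * by rewrite rmorphD; apply: PD.
    * by rewrite rmorphM; apply: PM.
  + have -> : loc_inv ('X : {poly K}) = (kappa^-1)%:K * laurent_f kappa.
      by rewrite scalK.
    by apply: PM.
  + exact: PD.
  + exact: PM.
have [ev [evC evX]] := poly_univ (fun a => scalC a e').
have [||phi [hphi phiE phiV]] :=
  @loc_univ K _ C 'X ev ((kappa^-1)%:K * f') evC.
- by rewrite evX scal_comm ef -rmorphM mulVf ?rmorph1.
- by rewrite evX -mulrA fe -rmorphM mulVf ?rmorph1.
exists phi; split=> //; first by rewrite phiE.
by rewrite rmorphM hphi phiV scalVK.
Qed.

Lemma laurent_embedding :
  exists phi : {rmorphism L -> F},
    [/\ alg_hom phi, injective phi & forall p, phi (lin p) = tofrac p].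
Proof.
have X0 : tofrac 'X != 0 :> F by rewrite tofrac_eq0 polyX_eq0.
pose phi0 : {rmorphism {poly K} -> F} := @tofrac {poly K}.
have hphi0 : alg_hom phi0 by [].
have [||phi [hphi phiE _]] := @loc_univ K _ F 'X phi0 (tofrac 'X)^-1 hphi0.
- by rewrite divff.
- by rewrite mulVf.
exists phi; split=> //; apply: raddf_inj => a ha.
have polyC_mulC (p q : {poly K}) : p * q = q * p by apply: mulrC.
have [p [n hp]] := loc_num polyC_mulC a.
apply: (loc_num0 (n := n)); rewrite hp.
have : phi (lin p) = 0 by rewrite -hp rmorphM ha mul0r.
by rewrite phiE => /eqP; rewrite tofrac_eq0 => /eqP ->; rewrite rmorph0.
Qed.

(** The derivation is [X d/dX], extended from polynomials. *)
Lemma laurent_derivation :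
  exists2 d : derivation L, determined_by (fun D => D e = e) d
    & forall p, d (lin p) = lin ('X * p^`()).
Proof.
(* The factor ['X] makes [e] an eigenvector of eigenvalue one. *)
have dM (p q : {poly K}) :
    'X * (p * q)^`() = 'X * p^`() * q + p * ('X * q^`()).
  by rewrite derivM; ring.
pose d0 := @Derivation K {poly K} (fun p => 'X * p^`())
  (fun p q => etrans (congr1 _ (derivD p q)) (mulrDr _ _ _)) dM
  (fun c => etrans (congr1 _ (derivC c)) (mulr0 _)).
have [d [hd _]] := loc_derivation 'X d0.
exists d => //; split=> [|d' hd']; first by rewrite hd /= derivX mulr1.
apply: loc_der_eq; elim/poly_hom_ind=> [c||p q h1 h2|p q h1 h2].
- by rewrite -[c%:P]/(c%:K : {poly K}) loc_in_scal !der_scal.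
- by rewrite hd' hd /= derivX mulr1.
- by rewrite rmorphD !derD h1 h2.
- by rewrite rmorphM !derM h1 h2.
Qed.

End Laurent.

Section Cross.
Variable K : fieldType.
Local Notation F := {fraction {poly K}}.
Local Notation e := (cross_e K).
Local Notation f := (cross_f K).
Local Notation MP := {mpoly K[2]}.

Lemma mpoly2_ind (P : MP -> Prop) :
  (forall c : K, P c%:K) -> P (cross_e0 K) -> P (cross_f0 K) ->
  (forall p q, P p -> P q -> P (p + q)) ->
  (forall p q, P p -> P q -> P (p * q)) -> forall p, P p.
Proof.
move=> Pc Pe Pf PD PM p.
have P0 : P 0 by rewrite -(rmorph0 (@scal K MP)); apply: Pc.
have P1 : P 1 by rewrite -(rmorph1 (@scal K MP)); apply: Pc.
rewrite [p]mpolyE; apply: (big_ind P) => // m _.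
rewrite -mul_mpolyC; apply: (PM); first exact: Pc.
rewrite mpolyXE_id; apply: (big_ind P) => // i _.
elim: (m i) => [//|n IHn]; rewrite exprS; apply: (PM) => //.
by case: i {IHn} => [[|[|//]] hi]; [move: Pe|move: Pf];
   congr (P 'X__); apply: val_inj.
Qed.

Lemma cross_ind (P : cross K -> Prop) :
  (forall c, P c%:K) -> P e -> P f -> (forall a b, P a -> P b -> P (a + b)) ->
  (forall a b, P a -> P b -> P (a * b)) -> forall a, P a.
Proof.
move=> Pc Pe Pf PD PM; elim/quot_ind=> p.
elim/mpoly2_ind: p => [c|||p q|p q].
- exact: Pc.
- exact: Pe.
- exact: Pf.
- by rewrite rmorphD; apply: PD.
- by rewrite rmorphM; apply: PM.
Qed.

Lemma cross_ef : e * f = 0.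
Proof.
rewrite -rmorphM -(rmorph0 (quot_pi _)); apply: quot_rel.
by rewrite subr0.
Qed.

Lemma cross_comm (a b : cross K) : a * b = b * a.
Proof.
elim/quot_ind: a => a; elim/quot_ind: b => b.
by rewrite -!rmorphM [a * b]mulrC.
Qed.

Lemma cross_hyperbola : is_hyperbola e f 0.
Proof.
split=> [|||C e' f' ef fe]; rewrite ?rmorph0.
- exact: cross_comm.
- exact: cross_ef.
- exact: cross_ind.
rewrite rmorph0 in ef fe.
have [ev1 [ev1C ev1X]] := poly_univ (fun a => scalC a f').
have ev1e p : ev1 p * e' = e' * ev1 p.
  elim/poly_hom_ind: p => [c||p q h1 h2|p q h1 h2].
  - by rewrite ev1C scalC.
  - by rewrite ev1X ef fe.
  - by rewrite rmorphD mulrDl mulrDr h1 h2.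
  - by rewrite rmorphM -mulrA h2 !mulrA h1.
have [ev2 [ev2C ev2X]] := poly_univ ev1e.
pose u (i : 'I_2) : {poly {poly K}} := if val i == 0%N then 'X else 'X%:P.
pose ev : {rmorphism MP -> C} := ev2 \o (mmap (polyC \o polyC) u).
have hev : alg_hom ev by move=> c; rewrite /= mmapC /= ev2C ev1C.
have eve : ev (cross_e0 K) = e' by rewrite /= mmapX mmap1U ev2X.
have evf : ev (cross_f0 K) = f' by rewrite /= mmapX mmap1U ev2C ev1X.
have [|phi [hphi phiE]] :=
    @quot_univ _ _ _ (fun p : MP => p = cross_e0 K * cross_f0 K) ev hev.
  by move=> _ ->; rewrite rmorphM eve evf.
by exists phi; split=> //; rewrite phiE.
Qed.

(** Since [e f = 0], every element is [p(e) + f q(f)]: such elements are stable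
    under multiplication by [e] and by [f]. *)
Lemma cross_normal_form (a : cross K) (eve evf : {rmorphism {poly K} -> cross K}) :
  alg_hom eve -> alg_hom evf -> eve 'X = e -> evf 'X = f ->
  exists p q, a = eve p + f * evf q.
Proof.
move=> heve hevf evX evfX.
(* Induction on [a] needs a statement about multiplication by [a]. *)
pose N b := exists p q, b = eve p + f * evf q.
suff aN b : N b -> N (a * b).
  have := aN 1; rewrite mulr1; apply.
  by exists 1, 0; rewrite !rmorph1 rmorph0 mulr0 addr0.
elim/cross_ind: a b => [c b|b|b|a1 a2 h1 h2 b|a1 a2 h1 h2 b].
- move=> [p [q ->]]; exists (c%:P * p), (c%:P * q).
  by rewrite !rmorphM heve hevf mulrDr scal_comm.
- move=> [p [q ->]]; exists ('X * p), 0.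
  by rewrite rmorphM evX mulrDr [e * (f * _)]mulrA cross_ef rmorph0 mul0r mulr0.
- move=> [p [q ->]]; exists 0, ((p`_0)%:P + 'X * q).
  have fp : f * eve p = f * (p`_0)%:K.
    elim/poly_ind: p => [|p c _]; first by rewrite coef0 !rmorph0.
    rewrite coefD coefMX coefC add0r rmorphD rmorphM evX mulrDr.
    rewrite heve [eve p * e]cross_comm mulrA [f * e]cross_comm cross_ef.
    by rewrite mul0r add0r.
  by rewrite mulrDr fp rmorph0 add0r rmorphD hevf rmorphM evfX mulrDr.
- move=> Nb; have [p1 [q1 E1]] := h1 b Nb; have [p2 [q2 E2]] := h2 b Nb.
  exists (p1 + p2), (q1 + q2).
  by rewrite mulrDl E1 E2 !rmorphD mulrDr addrACA.
- by move=> Nb; rewrite -mulrA; apply: h1; apply: h2.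
Qed.

(** A point of the crossing lines: one of the coordinates must vanish. *)
Lemma cross_branch (u v : {poly K}) : u * v = 0 ->
  exists phi : {rmorphism cross K -> F},
    [/\ alg_hom phi, phi e = tofrac u & phi f = tofrac v].
Proof.
move=> uv; apply: (hyp_univ cross_hyperbola).
  by rewrite -rmorphM uv !rmorph0.
by rewrite -rmorphM mulrC uv !rmorph0.
Qed.

(** The generic points of the two lines suffice: the first one recovers [p] from
    [p(e) + f q(f)], then the second one recovers [q]; and [e - f + b] is a
    nonconstant function on each line. *)
Lemma cross_separated (b : K) : separated (e - f + b%:K).
Proof.
move=> a ha.
have [eve [heve eveX]] := poly_univ (fun c => scalC c e).
have [evf [hevf evfX]] := poly_univ (fun c => scalC c f).
have [p [q aE]] := cross_normal_form a heve hevf eveX evfX.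
have evE (phi : {rmorphism cross K -> F}) (ev : {rmorphism {poly K} -> cross K}) r :
    alg_hom phi -> alg_hom ev -> phi (ev 'X) = tofrac 'X ->
    phi (ev r) = tofrac r.
  move=> hphi hev hX; elim/poly_hom_ind: r => [c||p1 p2 h1 h2|p1 p2 h1 h2].
  - by rewrite -[c%:P]/(c%:K : {poly K}) hev hphi.
  - by rewrite hX.
  - by rewrite !rmorphD h1 h2.
  - by rewrite !rmorphM h1 h2.
have [phi [hphi phie phif]] := cross_branch (mulr0 'X).
have [psi [hpsi psie psif]] := cross_branch (mul0r 'X).
have nz (c : K) : 'X + c%:P != 0 :> {poly K}.
  by rewrite -size_poly_eq0 size_XaddC.
have p0 : p = 0.
  have : phi a = 0.
    apply: ha => //; rewrite rmorphD rmorphB hphi phie phif rmorph0 subr0.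
    by rewrite -rmorphD tofrac_eq0 nz.
  rewrite aE rmorphD rmorphM phif rmorph0 mul0r addr0 (evE phi) ?eveX //.
  by move/eqP; rewrite tofrac_eq0 => /eqP.
have q0 : q = 0.
  have : psi a = 0.
    apply: ha => //; rewrite rmorphD rmorphB hpsi psie psif rmorph0 add0r.
    rewrite -rmorphN -rmorphD tofrac_eq0 -oppr_eq0 opprD opprK.
    by rewrite -polyCN nz.
  rewrite aE p0 rmorph0 add0r rmorphM psif (evE psi) ?evfX //.
  move/eqP; rewrite mulf_eq0 !tofrac_eq0 polyX_eq0 /= => /eqP //.
by rewrite aE p0 q0 !rmorph0 mulr0 addr0.
Qed.

(** The Euler-type derivation [X d/dX - Y d/dY] kills [X Y], so it descends. *)
Lemma cross_derivation :
  exists d : derivation (cross K),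
    determined_by (fun D => D e = e /\ D f = - f) d.
Proof.
pose i0 := @Ordinal 2 0 isT; pose i1 := @Ordinal 2 1 isT.
pose D (p : MP) : MP := 'X_i0 * mderiv i0 p - 'X_i1 * mderiv i1 p.
have DD : {morph D : p q / p + q} by move=> p q; rewrite /D !mderivD; ring.
have DM p q : D (p * q) = D p * q + p * D q by rewrite /D !mderivM; ring.
have Dc (c : K) : D c%:K = 0 by rewrite /D !mderivC !mulr0 subrr.
have UU (i : 'I_2) : (U_(i) - U_(i) = 0)%MM by rewrite -{1}[U_(i)%MM]add0m addmK.
have DX0 : D 'X_i0 = 'X_i0.
  by rewrite /D !mderivX !mnmE /= scale0r mulr0 subr0 scale1r UU mpolyX0 mulr1.
have DX1 : D 'X_i1 = - 'X_i1.
  rewrite /D !mderivX !mnmE /= scale0r mulr0 sub0r scale1r UU mpolyX0.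
  by rewrite mulr1.
have [|d dE] := quot_derivation
    (S := fun p : MP => p = cross_e0 K * cross_f0 K) (d := Derivation DD DM Dc).
  move=> _ ->; rewrite /= DM DX0 DX1 mulrN subrr; exact: gen_ideal0.
have de : d e = e by rewrite dE /= DX0.
have df : d f = - f by rewrite dE /= DX1 rmorphN.
exists d; split=> // d' [h1 h2].
by apply: (hyp_der_eq cross_hyperbola); rewrite ?h1 ?h2.
Qed.

End Cross.

(** * Recognizing a localization *)

Section Recognition.
Variables (K : fieldType) (B U : pzAlgType K) (s : B) (t : U).
Variable iota : {rmorphism B -> U}.
Hypothesis iota_alg : alg_hom iota.
Hypothesis iota_inj : injective iota.
Hypothesis st : iota s * t = 1.
Hypothesis ts : t * iota s = 1.
Hypothesis right_frac : forall x, exists b n, x * iota s ^+ n = iota b.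
Hypothesis left_frac : forall x, exists b n, iota s ^+ n * x = iota b.

(** The right Ore condition [t^n b s^k = b'] holds in [U], where it becomes
    [b s^k = s^n b'] after multiplication by [s^n]; this form only involves [B],
    so it can be read off in the formally defined localization. *)
Lemma loc_right_frac (y : loc s) : exists b n, y * loc_in s s ^+ n = loc_in s b.
Proof.
elim/loc_ind: y => [a||x y [a [n ha]] [b [m hb]]|x y [a [n ha]] [b [m hb]]].
- by exists a, 0%N; rewrite mulr1.
- by exists 1, 1%N; rewrite loc_mulVr rmorph1.
- exists (a * s ^+ m + b * s ^+ n), (n + m)%N.
  by rewrite mulrDl {1}exprD addnC exprD !mulrA ha hb rmorphD !rmorphM !rmorphXn.
have [b' [k hb']] := right_frac (t ^+ n * iota b).
have bsk : b * s ^+ k = s ^+ n * b'.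
  apply: iota_inj; rewrite !rmorphM !rmorphXn -hb' -!mulrA mulrA.
  by rewrite (exprVK n st) mul1r.
exists (a * b'), (m + k)%N.
rewrite exprD mulrA -[x * y * _]mulrA hb -mulrA -rmorphXn -rmorphM bsk.
by rewrite rmorphM mulrA rmorphXn ha rmorphM.
Qed.

(** An injective morphism that inverts [s] and over which denominators can be
    cleared on both sides is the universal localization: fractions make the
    comparison map surjective and reduce its kernel to that of [iota]. *)
Lemma loc_recognition :
  ore_localization s (loc_in s) /\
  exists psi : {rmorphism U -> loc s},
    alg_iso psi /\ forall b, psi (iota b) = loc_in s b.
Proof.
have [ev [hev evE evV]] := @loc_univ K B U s iota t iota_alg st ts.
have sK n : loc_in s s ^+ n * loc_inv s ^+ n = 1 := exprVK n (loc_mulV s).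
have ev_inj : injective ev.
  apply: raddf_inj => y hy; have [b [n yb]] := loc_right_frac y.
  have b0 : b = 0.
    by apply: iota_inj; rewrite -evE -yb rmorphM hy mul0r rmorph0.
  by rewrite -[y]mulr1 -(sK n) mulrA yb b0 rmorph0 mul0r.
have ev_surj x : exists y, ev y = x.
  have [b [n xb]] := right_frac x; exists (loc_in s b * loc_inv s ^+ n).
  by rewrite rmorphM rmorphXn evE evV -xb -mulrA (exprVK n st) mulr1.
have loc_in0 a : loc_in s a = 0 -> a = 0.
  by move=> a0; apply: iota_inj; rewrite -evE a0 !rmorph0.
split; first split=> [|x|x|a /loc_in0 ->|a /loc_in0 ->].
- by exists (loc_inv s); rewrite loc_mulV loc_mulVr.
- exact: loc_right_frac.
- have [b [n xb]] := left_frac (ev x); exists b, n.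
  by apply: ev_inj; rewrite rmorphM rmorphXn !evE.
- by exists 0%N; rewrite mul0r.
- by exists 0%N; rewrite mulr0.
have /choice[g gK] := ev_surj.
have [|psi [hpsi psiK psiK']] := @alg_iso_inverse K _ _ ev.
  by split=> //; exists g => x //; apply: ev_inj; rewrite gK.
by exists psi; split=> // b; rewrite -evE psiK.
Qed.

End Recognition.

(** * Ore extensions: coefficients, functoriality, fractions *)

Section OreCoefficients.
Variables (K : fieldType) (A : pzAlgType K) (d : derivation A).

Definition ore_coef (n : nat) (p : ore_ext d) : A := monalg.mcoeff n p.

Lemma ore_coefD n : {morph ore_coef n : p q / p + q}.
Proof. exact: monalg.mcoeffD. Qed.

Lemma ore_coef0 n : ore_coef n 0 = 0.
Proof. exact: monalg.mcoeff0. Qed.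

Lemma ore_coef_term n a k : ore_coef n (ore_term d a k) = a *+ (k == n).
Proof. by rewrite ore_termU; apply: monalg.mcoeffU. Qed.

Lemma ore_coefP (p q : ore_ext d) : (forall n, ore_coef n p = ore_coef n q) -> p = q.
Proof. by move=> h; apply/monalg.malgP. Qed.

End OreCoefficients.

Section OreFunctoriality.
Variables (K : fieldType) (A L : pzAlgType K).
Variables (d : derivation A) (d' : derivation L) (phi : {rmorphism A -> L}).
Hypothesis phi_alg : alg_hom phi.
Hypothesis phi_der : der_extends phi d d'.

Lemma ore_map : exists iota : {rmorphism ore_ext d -> ore_ext d'},
  [/\ alg_hom iota, forall a, iota (ore_in d a) = ore_in d' (phi a)
    & iota (ore_h d) = ore_h d'].
Proof.
pose psi : {rmorphism A -> ore_ext d'} := ore_in d' \o phi.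
have hpsi : alg_hom psi by move=> c; rewrite /= phi_alg.
have [|iota [h1 h2 h3]] := @ore_univ K A _ d psi (ore_h d') hpsi.
  by move=> a; rewrite ore_h_comm /= phi_der.
by exists iota.
Qed.

Lemma ore_map_inj (iota : {rmorphism ore_ext d -> ore_ext d'}) :
  (forall a, iota (ore_in d a) = ore_in d' (phi a)) ->
  iota (ore_h d) = ore_h d' -> injective phi -> injective iota.
Proof.
move=> iota_in iota_h phi_inj.
have coefE n p : ore_coef n (iota p) = phi (ore_coef n p).
  elim/ore_ind: p => [a k|p q h1 h2].
    rewrite ore_termE rmorphM rmorphXn iota_in iota_h -!ore_termE !ore_coef_term.
    by rewrite rmorphMn.
  by rewrite rmorphD !ore_coefD h1 h2 rmorphD.
apply: raddf_inj => p p0; apply: ore_coefP => n; apply: phi_inj.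
by rewrite -coefE p0 !ore_coef0 rmorph0.
Qed.

End OreFunctoriality.

Section OreFractions.
Variables (K : fieldType) (A : pzAlgType K) (s : A).
Variables (d : derivation A) (d' : derivation (loc s)).
Hypothesis mulA_comm : forall a b : A, a * b = b * a.
Variable iota : {rmorphism ore_ext d -> ore_ext d'}.
Hypothesis iota_in : forall a, iota (ore_in d a) = ore_in d' (loc_in s a).
Hypothesis iota_h : iota (ore_h d) = ore_h d'.
Local Notation sO := (ore_in d s).

Lemma ore_left_frac x : exists p n, iota sO ^+ n * x = iota p.
Proof.
elim/ore_ind: x => [a k|x y [p [n hp]] [q [m hq]]].
  have [b [n ab]] := loc_num mulA_comm a.
  exists (ore_in d b * ore_h d ^+ k), n.
  rewrite ore_termE rmorphM rmorphXn iota_in iota_h mulrA iota_in -rmorphXn.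
  by rewrite -rmorphM (loc_comm mulA_comm) ab.
exists (sO ^+ m * p + sO ^+ n * q), (n + m)%N.
by rewrite mulrDr {1}addnC !exprD -!mulrA hp hq rmorphD !rmorphM !rmorphXn.
Qed.

Lemma der_expr a n : exists b, d (a ^+ n.+1) = a ^+ n * b.
Proof.
elim: n => [|n [b hb]]; first by exists (d a); rewrite expr1 mul1r.
exists (d a + b); rewrite exprS derM hb mulrDr; congr (_ + _).
  by rewrite mulA_comm.
by rewrite mulrA -exprS.
Qed.

(** Moving [s^(n+k)] to the left of [h^k] costs at most one power of [s] for each
    [h], since [h a^(n+1) = a^(n+1) h + d (a^(n+1))] and [d (a^(n+1))] is divisible
    by [a^n]. *)
Lemma ore_h_expr k n : exists p, ore_h d ^+ k * sO ^+ (n + k) = sO ^+ n * p.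
Proof.
elim: k n => [|k IHk] n; first by exists 1; rewrite mul1r addn0 mulr1.
have [p hp] := IHk n.+1; have [b hb] := der_expr s n.
exists ((sO * ore_h d + ore_in d b) * p).
rewrite exprS -mulrA addnS -addSn hp mulrA -rmorphXn.
have := ore_h_comm d (s ^+ n.+1); move/eqP; rewrite subr_eq => /eqP ->.
rewrite hb rmorphM !rmorphXn addrC exprSr -(mulrA _ sO) -mulrDr -mulrA.
by [].
Qed.

Lemma ore_right_frac x : exists p n, x * iota sO ^+ n = iota p.
Proof.
elim/ore_ind: x => [a k|x y [p [n hp]] [q [m hq]]].
  have [b [n ab]] := loc_num mulA_comm a.
  have [p hp] := ore_h_expr k n.
  exists (ore_in d b * p), (n + k)%N.
  rewrite ore_termE -mulrA -iota_h -!(rmorphXn iota) -(rmorphM iota) hp rmorphM mulrA.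
  by rewrite (rmorphXn iota) !iota_in -rmorphXn -rmorphM ab rmorphM iota_in.
exists (p * sO ^+ m + q * sO ^+ n), (n + m)%N.
by rewrite mulrDl {1}exprD addnC exprD !mulrA hp hq rmorphD !rmorphM !rmorphXn.
Qed.

End OreFractions.

(** It suffices to know a commutator with [h] on [A]: on [s^-1] both sides are
    given by the quotient rule. *)
Lemma loc_commutator (K : fieldType) (A C : pzAlgType K) (s : A)
    (d : derivation A) (d' : derivation (loc s))
    (psi : {rmorphism loc s -> C}) (h : C) : der_extends (loc_in s) d d' ->
  (forall a, h * psi (loc_in s a) - psi (loc_in s a) * h = psi (loc_in s (d a))) ->
  forall x, h * psi x - psi x * h = psi (d' x).
Proof.
move=> hd' ha; elim/loc_ind=> [a||x y h1 h2|x y h1 h2].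
- by rewrite ha hd'.
- rewrite (der_inv _ (loc_mulV s) (loc_mulVr s)) hd' rmorphN !rmorphM -ha.
  rewrite mulrBr mulrBl opprB -!mulrA -!rmorphM loc_mulV rmorph1 mulr1.
  by rewrite !mulrA -rmorphM loc_mulVr rmorph1 mul1r.
- by rewrite rmorphD mulrDr mulrDl opprD addrACA h1 h2 derD rmorphD.
- by rewrite rmorphM commutatorM h1 h2 derM rmorphD !rmorphM.
Qed.

(** * U^alpha as an Ore extension *)

Section Core.
Variables (K : fieldType) (lambda alpha s c : K).
Hypothesis two_neq0 : 2%:R != 0 :> K.
Hypothesis s_neq0 : s != 0.
Hypothesis s_sqrt : s ^+ 2 = 2%:R * lambda.
Hypothesis alphaE : alpha = 2%:R * s * c.
Local Notation kappa := (s ^+ 2 - c ^+ 2).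
Local Notation Ua := (Ualpha lambda alpha).
Local Notation in_ := (Ualpha_in lambda alpha).
Local Notation H := (Uh lambda alpha s).
Local Notation E := (Ue lambda alpha s).
Local Notation Fe := (Uf lambda alpha s).

Let cE : alpha / (2%:R * s) = c.
Proof. by rewrite alphaE mulrAC divff ?mul1r // mulf_neq0. Qed.

Lemma UeE : E = in_ Ux - (s%:K * in_ Ug + c%:K).
Proof. by rewrite /Ue cE opprD addrA. Qed.

Lemma UfE : Fe = in_ Ux + (s%:K * in_ Ug + c%:K).
Proof. by rewrite /Uf cE addrA. Qed.

Lemma UxE : in_ Ux = (2%:R^-1)%:K * (E + Fe).
Proof. by rewrite UeE UfE half_sum. Qed.

Lemma UgE : in_ Ug = (s^-1)%:K * ((2%:R^-1)%:K * (Fe - E) - c%:K).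
Proof. by rewrite UeE UfE half_diff // addrK scalK. Qed.

Lemma UyE : in_ Uy = s%:K * (H * in_ Ug).
Proof.
have [[_ gVg] _ _ _ _] := Ualpha_relations lambda alpha.
by rewrite /Uh -!mulrA gVg mulr1 scalVK.
Qed.

Lemma U_hyperbola : [/\ E * Fe = kappa%:K, Fe * E = kappa%:K,
  H * E - E * H = E & H * Fe - Fe * H = - Fe].
Proof.
have [xw xx hw hx] := Urelations_hyperbolic two_neq0 s_neq0 s_sqrt alphaE
  (Ualpha_relations lambda alpha).
by rewrite UeE UfE; apply: hyperbola.
Qed.

(** As an algebra, U^alpha is generated by [h], [e], [f] and the inverse of [g]. *)
Lemma Ualpha_hef_ind (P : Ua -> Prop) :
  (forall k, P k%:K) -> P H -> P E -> P Fe ->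
  (forall a b, P a -> P b -> P (a + b)) ->
  (forall a b, P a -> P b -> P (a * b)) ->
  (P (in_ Ug) -> P (in_ UgV)) -> forall a, P a.
Proof.
move=> Pc Ph Pe Pf PD PM PV.
have PN a : P a -> P (- a).
  by move=> Pa; rewrite -mulN1r -(rmorphN1 (@scal K Ua)); apply: (PM) Pa; apply: Pc.
have Pk k a : P a -> P (k%:K * a) by apply: (PM).
have Pg : P (in_ Ug).
  rewrite UgE; apply: (Pk); apply: (PD); last exact/PN/Pc.
  by apply: (Pk); apply: (PD) => //; apply: PN.
elim/Ualpha_ind=> [k|[|||]|a b|a b].
- exact: Pc.
- exact: Pg.
- exact: PV.
- by rewrite UxE; apply: (Pk); apply: PD.
- by rewrite UyE; apply: (Pk); apply: PM.
- exact: PD.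
- exact: PM.
Qed.

Variables (A : pzAlgType K) (e f : A) (d : derivation A).
Hypothesis hyp : is_hyperbola e f kappa.
Hypothesis de : d e = e.
Hypothesis df : d f = - f.
Variables (gL u v : A).
Hypothesis uv : u * v = 1.
Hypothesis gLE : gL = u * (e - f + (2%:R * c)%:K).
Hypothesis sep : separated gL.
Variable d' : derivation (loc gL).
Hypothesis hd' : der_extends (loc_in gL) d d'.
Local Notation O := (ore_ext d).
Local Notation O' := (ore_ext d').
Local Notation lin := (loc_in gL).

Lemma ore_loc_ind (P : O' -> Prop) :
  (forall k, P k%:K) -> P (ore_h d') -> P (ore_in d' (lin e)) ->
  P (ore_in d' (lin f)) ->
  (forall a b, P a -> P b -> P (a + b)) ->
  (forall a b, P a -> P b -> P (a * b)) ->
  (P (ore_in d' (lin gL)) -> P (ore_in d' (loc_inv gL))) -> forall p, P p.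
Proof.
move=> Pc Ph Pe Pf PD PM PV.
have Pin a : P (ore_in d' (lin a)).
  elim/(hyp_ind hyp): a => [k|||a b|a b] //.
  - by rewrite loc_in_scal; apply: Pc.
  - by rewrite !rmorphD; apply: PD.
  - by rewrite !rmorphM; apply: PM.
elim/ore_ind_mul=> [x||p q|p q] //; [|exact: PD|exact: PM].
elim/loc_ind: x => [a||x y|x y].
- exact: Pin.
- exact: PV.
- by rewrite rmorphD; apply: PD.
- by rewrite rmorphM; apply: PM.
Qed.

(** The images of [x], [w] and [g] are forced by [e = x - w], [f = x + w] and
    [w = s g + c]; the image of [g] is a unit because it divides [gL]. *)
Lemma to_ore : exists Phi : {rmorphism Ua -> O'},
  [/\ alg_hom Phi, Phi H = ore_h d', Phi E = ore_in d' (lin e)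
    & Phi Fe = ore_in d' (lin f)].
Proof.
pose jn : {rmorphism A -> O'} := ore_in d' \o lin.
have hjn : alg_hom jn by move=> k; rewrite /= loc_in_scal.
pose X := (2%:R^-1)%:K * (e + f); pose W := (2%:R^-1)%:K * (f - e).
pose g := (s^-1)%:K * (W - c%:K).
have WE : jn W = s%:K * jn g + c%:K.
  have -> : jn g = (s^-1)%:K * (jn W - c%:K) by rewrite rmorphM rmorphB !hjn.
  by rewrite scalVK // subrK.
have half a : (2%:R^-1)%:K * (a + a) = a :> A by rewrite scal2 scalK.
have eE : X - W = e.
  by rewrite /X /W -mulrBr opprB addrACA subrr addr0 half.
have fE : X + W = f.
  by rewrite /X /W -mulrDr [e + f]addrC addrACA subrr addr0 half.
have dk (k : K) a : d (k%:K * a) = k%:K * d a by rewrite derM der_scal mul0r add0r.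
have dN a : d (- a) = - d a.
  by rewrite -mulN1r -(rmorphN1 (@scal K A)) dk rmorphN1 mulN1r.
have dX : d X = - W.
  by rewrite dk derD de df -mulrN opprB.
have dW : d W = - X.
  by rewrite dk derD dN de df -mulrN opprD addrC.
have XX : X ^+ 2 = W ^+ 2 + kappa%:K.
  have -> : kappa%:K = X ^+ 2 - W ^+ 2 :> A.
    rewrite -(hyp_rel hyp) -eE -fE mulrBl !mulrDr [W * X](hyp_comm hyp) opprD.
    by rewrite addrA addrK.
  by rewrite addrC subrK.
(* The cofactor comes from [e - f + 2 c = - 2 s g]. *)
have gV : exists b, g * b = gL.
  exists (u * (- (2%:R * s))%:K).
  rewrite gLE mulrA [g * u](hyp_comm hyp) -mulrA; congr (_ * _).
  rewrite -scalC /g mulrA -rmorphM.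
  have -> : - (2%:R * s) * s^-1 = - 2%:R by rewrite mulNr mulfK.
  rewrite rmorphN mulNr mulrBr /W scalVK // -rmorphM !opprB.
  by rewrite addrC.
have [b gb] := gV.
pose V := ore_in d' (lin b * loc_inv gL).
have gV1 : jn g * V = 1.
  rewrite -[jn g]/(ore_in d' (lin g)) -(rmorphM (ore_in d')) mulrA.
  by rewrite -(rmorphM lin) gb loc_mulV rmorph1.
have gV2 : V * jn g = 1.
  rewrite -gV1 -[jn g]/(ore_in d' (lin g)) -!(rmorphM (ore_in d')).
  by rewrite [X in ore_in _ X = _](loc_comm (hyp_comm hyp)).
have comm a a' : jn a * jn a' = jn a' * jn a.
  by rewrite -!(rmorphM jn) [a * a'](hyp_comm hyp).
have hjnd a : ore_h d' * jn a - jn a * ore_h d' = jn (d a).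
  by rewrite ore_h_comm hd'.
have [] // := @hyperbolic_Urelations K lambda alpha s c two_neq0 s_neq0 s_sqrt
  alphaE O' (jn g) V (jn X) (ore_h d') gV1 gV2; rewrite -?WE //.
- by rewrite -!rmorphXn XX rmorphD hjn.
- by rewrite hjnd dW rmorphN.
- by rewrite hjnd dX rmorphN.
move=> ggV gx gy yx xx.
have [Phi [hPhi Pg PgV Px Py]] := Ualpha_univ (And5 ggV gx gy yx xx).
exists Phi; split=> //.
- rewrite /Uh rmorphM hPhi rmorphM Py PgV -!mulrA gV1 mulr1 scalK //.
- by rewrite UeE rmorphB rmorphD rmorphM !hPhi Px Pg -WE -rmorphB eE.
- by rewrite UfE !rmorphD rmorphM !hPhi Px Pg -WE -rmorphD fE.
Qed.

(** In U^alpha, [e - f + 2 c = - 2 s g] is a unit, and so is the image of [gL]. *)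
Lemma from_ore : exists Psi : {rmorphism O' -> Ua},
  [/\ alg_hom Psi, Psi (ore_h d') = H, Psi (ore_in d' (lin e)) = E
    & Psi (ore_in d' (lin f)) = Fe].
Proof.
have [EF FE HE HF] := U_hyperbola.
have [th [hth the thf]] := hyp_univ hyp EF FE.
have [[ggV gVg] _ _ _ _] := Ualpha_relations lambda alpha.
pose k := - (2%:R * s); have k0 : k != 0 by rewrite oppr_eq0 mulf_neq0.
have thg : th gL = th u * (k%:K * in_ Ug).
  rewrite gLE rmorphM; congr (_ * _); rewrite rmorphD rmorphB the thf hth.
  rewrite UgE mulrA -rmorphM /k mulNr mulfK // rmorphN mulNr mulrBr scalVK //.
  by rewrite -rmorphM !opprB addrC.
pose t := in_ UgV * ((k^-1)%:K * th v).
have [||ps [hps psE psV]] := @loc_univ K A Ua gL th t hth.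
- rewrite thg /t -!mulrA [in_ Ug * _]mulrA ggV mul1r scalVK // -rmorphM uv.
  by rewrite rmorph1.
- rewrite thg /t -!mulrA [th v * _]mulrA -rmorphM (hyp_comm hyp) uv rmorph1.
  by rewrite mul1r scalK.
have HA a : H * th a - th a * H = th (d a).
  elim/(hyp_ind hyp): a => [a|||a b h1 h2|a b h1 h2].
  - by rewrite hth scalC subrr der_scal rmorph0.
  - by rewrite the HE de the.
  - by rewrite thf HF df rmorphN thf.
  - by rewrite rmorphD mulrDr mulrDl opprD addrACA h1 h2 derD rmorphD.
  - by rewrite rmorphM commutatorM h1 h2 derM rmorphD !rmorphM.
have HL x : H * ps x - ps x * H = ps (d' x).
  by apply: (loc_commutator hd') => a; rewrite !psE.
have [Psi [hPsi PsiE Psih]] := ore_univ hps HL.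
by exists Psi; split=> //; rewrite PsiE psE.
Qed.

Lemma Ualpha_ore : exists Phi : {rmorphism Ua -> O'},
  [/\ alg_iso Phi, Phi H = ore_h d', Phi E = ore_in d' (lin e)
    & Phi Fe = ore_in d' (lin f)].
Proof.
have [Phi [hPhi PhiH PhiE PhiF]] := to_ore.
have [Psi [hPsi PsiH PsiE PsiF]] := from_ore.
have inv_uniq (R : pzRingType) (a b b' : R) : a * b = 1 -> b' * a = 1 -> b' = b.
  by move=> ab ba; rewrite -[b']mulr1 -ab mulrA ba mul1r.
exists Phi; split=> //; split=> //; exists Psi.
- elim/Ualpha_hef_ind=> [k||||a b h1 h2|a b h1 h2|h].
  + by rewrite hPhi hPsi.
  + by rewrite PhiH.
  + by rewrite PhiE.
  + by rewrite PhiF.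
  + by rewrite !rmorphD h1 h2.
  + by rewrite !rmorphM h1 h2.
  have [[ggV gVg] _ _ _ _] := Ualpha_relations lambda alpha.
  apply: inv_uniq ggV _.
  by rewrite -h -(rmorphM Psi) -(rmorphM Phi) gVg !rmorph1.
- elim/ore_loc_ind=> [k||||a b h1 h2|a b h1 h2|h].
  + by rewrite hPsi hPhi.
  + by rewrite PsiH.
  + by rewrite PsiE.
  + by rewrite PsiF.
  + by rewrite !rmorphD h1 h2.
  + by rewrite !rmorphM h1 h2.
  apply: (inv_uniq _ (ore_in d' (lin gL))).
    by rewrite -rmorphM loc_mulV rmorph1.
  by rewrite -h -(rmorphM Phi) -(rmorphM Psi) -rmorphM loc_mulVr !rmorph1.
Qed.

Let hB := Bh lambda alpha s.
Let eB := Be lambda alpha s.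
Let fB := Bf lambda alpha s.
Local Notation B := (B lambda alpha s).

(** The composite of [iota] with the inverse of [Phi] is injective and its image is
    the subalgebra generated by [h], [e], [f]. *)
Lemma B_ore (Phi : {rmorphism Ua -> O'}) (iota : {rmorphism O -> O'}) :
  alg_iso Phi -> Phi H = ore_h d' -> Phi E = ore_in d' (lin e) ->
  Phi Fe = ore_in d' (lin f) -> alg_hom iota ->
  (forall a, iota (ore_in d a) = ore_in d' (lin a)) ->
  iota (ore_h d) = ore_h d' ->
  exists phi : {rmorphism B -> O},
   [/\ [/\ alg_iso phi, phi hB = ore_h d, phi eB = ore_in d e
         & phi fB = ore_in d f] & forall b, Phi (Bval b) = iota (phi b)].
Proof.
move=> isoPhi PhiH PhiE PhiF hiota iota_in iota_h.
have iota_inj : injective iota.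
  exact: (ore_map_inj iota_in iota_h (separated_loc_inj sep)).
have [Psi [[hPsi [_ _ _]] PhiK PsiK]] := alg_iso_inverse isoPhi.
pose th : {rmorphism O -> Ua} := Psi \o iota.
have hth : alg_hom th by apply: comp_hom.
have the : th (ore_in d e) = E by rewrite /= iota_in -PhiE PhiK.
have thf : th (ore_in d f) = Fe by rewrite /= iota_in -PhiF PhiK.
have thh : th (ore_h d) = H by rewrite /= iota_h -PhiH PhiK.
have thB p : gen_subalg (Bgens (lambda := lambda) (alpha := alpha) s) (th p).
  elim/ore_ind_mul: p => [a||p q h1 h2|p q h1 h2].
  - elim/(hyp_ind hyp): a => [k|||a b h1 h2|a b h1 h2].
    + by rewrite hth; apply: gen_subalg_scal.
    + by rewrite the; apply/gen_subalg_gen/Or32.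
    + by rewrite thf; apply/gen_subalg_gen/Or33.
    + by rewrite !rmorphD; apply: gen_subalgD.
    + by rewrite !rmorphM; apply: gen_subalgM.
  - by rewrite thh; apply/gen_subalg_gen/Or31.
  - by rewrite rmorphD; apply: gen_subalgD.
  - by rewrite rmorphM; apply: gen_subalgM.
have [th' [hth' th'E]] := corestrict hth thB.
have th_inj : injective th by move=> p q /(can_inj PsiK)/iota_inj.
have th'_surj b : exists p, th' p = b.
  suff [p hp] : exists p, th p = Bval b.
    by exists p; apply: val_inj; rewrite /= th'E.
  have /subalg_predP : Bval b \in subalg_pred _ := subalg_valP b.
  elim=> [_ [->|->|->]|k|a a' _ [p <-] _ [q <-]|a a' _ [p <-] _ [q <-]].
  - by exists (ore_h d).
  - by exists (ore_in d e).
  - by exists (ore_in d f).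
  - by exists k%:K.
  - by exists (p + q); rewrite rmorphD.
  - by exists (p * q); rewrite rmorphM.
have /choice[g gK] := th'_surj.
have [|phi [hphi th'K phiK]] := @alg_iso_inverse K _ _ th'.
  split=> //; exists g => p //; apply: th_inj.
  by rewrite -!th'E gK.
have phiE p b : th p = Bval b -> phi b = p.
  by move=> hp; apply: (can_inj th'K); rewrite phiK; apply: val_inj; rewrite /= th'E.
exists phi; split; first by split=> //; apply: phiE.
by move=> b; rewrite -(PsiK (iota _)) -[Psi _]th'E phiK.
Qed.

(** The element [gB] is only specified through its image under algebra morphisms,
    so that any expression in [e] and [f] that evaluates to [gL] in [A] will do. *)
Lemma B_localization (gB : B) :
  (forall phi : {rmorphism B -> O}, alg_hom phi -> phi eB = ore_in d e ->
     phi fB = ore_in d f -> phi gB = ore_in d gL) ->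
  [/\ exists phi : {rmorphism B -> O},
        [/\ alg_iso phi, phi hB = ore_h d, phi eB = ore_in d e
          & phi fB = ore_in d f],
      ore_localization gB (loc_in gB),
      exists psi : {rmorphism Ua -> loc gB},
        alg_iso psi /\ forall b, psi (Bval b) = loc_in gB b
    & exists chi : {rmorphism loc gB -> O'},
        [/\ alg_iso chi, chi (loc_in gB hB) = ore_h d',
            chi (loc_in gB eB) = ore_in d' (lin e)
          & chi (loc_in gB fB) = ore_in d' (lin f)]].
Proof.
move=> gBE; have [Phi [isoPhi PhiH PhiE PhiF]] := Ualpha_ore.
have [iota [hiota iota_in iota_h]] := ore_map (@loc_in_scal K A gL) hd'.
have [phi [[isophi phih phie phif] phiE]] :=
  B_ore isoPhi PhiH PhiE PhiF hiota iota_in iota_h.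
have [hphi _] := isophi; have phig := gBE phi hphi phie phif.
have [hPhi _] := isoPhi.
have [Psi [[hPsi _] PhiK PsiK]] := alg_iso_inverse isoPhi.
have [phi' [[hphi' _] phiK phi'K]] := alg_iso_inverse isophi.
have PhiG : Phi (Bval gB) = iota (ore_in d gL) by rewrite phiE phig.
pose t := Psi (ore_in d' (loc_inv gL)).
pose bv : {rmorphism B -> Ua} := (val : B -> Ua).
have bvE b : Phi (bv b) = iota (phi b) := phiE b.
have bvg : bv gB = Psi (ore_in d' (lin gL)).
  by rewrite -iota_in -phig -bvE PhiK.
have gBt : bv gB * t = 1.
  by rewrite bvg -(rmorphM Psi) -rmorphM loc_mulV !rmorph1.
have tgB : t * bv gB = 1.
  by rewrite bvg -(rmorphM Psi) -rmorphM loc_mulVr !rmorph1.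
have lift p : Phi (bv (phi' p)) = iota p by rewrite bvE phi'K.
have comm := hyp_comm hyp.
have right_frac x : exists b n, x * bv gB ^+ n = bv b.
  have [p [n hp]] := ore_right_frac comm iota_in iota_h (Phi x).
  exists (phi' p), n; apply: (can_inj PhiK).
  by rewrite lift -hp rmorphM rmorphXn PhiG.
have left_frac x : exists b n, bv gB ^+ n * x = bv b.
  have [p [n hp]] := ore_left_frac comm iota_in iota_h (Phi x).
  exists (phi' p), n; apply: (can_inj PhiK).
  by rewrite lift -hp rmorphM rmorphXn PhiG.
have [loc_gB [psi [isopsi psiE]]] := @loc_recognition K B Ua gB t bv (fun=> erefl)
  val_inj gBt tgB right_frac left_frac.
have [Xi [isoXi psiK XiK]] := alg_iso_inverse isopsi.
split=> //.
- by exists phi.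
- by exists psi.
have XiE b : Xi (loc_in gB b) = bv b by rewrite -psiE psiK.
exists (Phi \o Xi); rewrite /= !XiE !bvE phih phie phif iota_h !iota_in.
split=> //; split; first exact: comp_hom hPhi isoXi.1.
by apply: bij_comp isoPhi.2 isoXi.2.
Qed.
End Core.

(** * Leading coefficients, domains and simplicity *)

Section OreLeadingTerms.
Variables (K : fieldType) (A : pzAlgType K) (d : derivation A).
Local Notation O := (ore_ext d).
Implicit Types (p q : O) (a b : A).

Lemma ore_coef_in n a : ore_coef n (ore_in d a) = a *+ (n == 0%N).
Proof. by rewrite ore_coef_term eq_sym. Qed.

Lemma ore_coefM_in n a q : ore_coef n (ore_in d a * q) = a * ore_coef n q.
Proof.
elim/ore_ind: q => [b k|p q h1 h2].
  by rewrite ore_termE mulrA -rmorphM -[_ * _]ore_termE -ore_termE !ore_coef_term mulrnAr.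
by rewrite mulrDr !ore_coefD h1 h2 mulrDr.
Qed.

Lemma ore_h_term b k :
  ore_h d * ore_term d b k = ore_term d b k.+1 + ore_term d (d b) k.
Proof.
by rewrite /GRing.mul /= /ore_h ore_mul_term /= ore_lmul1 ore_hmul_term.
Qed.

Lemma ore_coefM_h0 q : ore_coef 0 (ore_h d * q) = d (ore_coef 0 q).
Proof.
elim/ore_ind: q => [b k|p q h1 h2].
  rewrite ore_h_term ore_coefD !ore_coef_term add0r.
  by case: k => [|k] //=; rewrite der0.
by rewrite mulrDr !ore_coefD h1 h2 derD.
Qed.

Lemma ore_coefM_h n q :
  ore_coef n.+1 (ore_h d * q) = ore_coef n q + d (ore_coef n.+1 q).
Proof.
elim/ore_ind: q => [b k|p q h1 h2].
  rewrite ore_h_term ore_coefD !ore_coef_term eqSS; congr (_ + _).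
  by case: (k == n.+1); rewrite ?der0.
by rewrite mulrDr !ore_coefD h1 h2 derD addrACA.
Qed.

Definition ore_below n p := forall k, (n <= k)%N -> ore_coef k p = 0.

Lemma ore_below_exists p : exists n, ore_below n p.
Proof.
elim/ore_ind: p => [a n|p q [n hn] [m hm]].
  by exists n.+1 => k nk; rewrite ore_coef_term ltn_eqF.
exists (maxn n m) => k; rewrite geq_max => /andP[nk mk].
by rewrite ore_coefD hn // hm // addr0.
Qed.

Lemma ore_below0 p : ore_below 0 p -> p = 0.
Proof. by move=> h; apply: ore_coefP => n; rewrite h // ore_coef0. Qed.

Lemma ore_leading p : p <> 0 ->
  exists n, ore_coef n p <> 0 /\ ore_below n.+1 p.
Proof.
move=> p0; have [n] := ore_below_exists p.
elim: n => [/ore_below0 //|n IHn] hn.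
have [c0|c0] := pselect (ore_coef n p = 0); last by exists n.
by apply: IHn => k; rewrite leq_eqVlt => /predU1P[<- //|]; apply: hn.
Qed.

Lemma ore_expand n p : ore_below n p ->
  p = \sum_(i < n) ore_in d (ore_coef i p) * ore_h d ^+ i.
Proof.
move=> hn; apply: ore_coefP => k.
have -> : ore_coef k (\sum_(i < n) ore_in d (ore_coef i p) * ore_h d ^+ i) =
    \sum_(i < n) ore_coef k (ore_in d (ore_coef i p) * ore_h d ^+ i).
  by apply: (big_morph _ (ore_coefD k) (ore_coef0 d k)).
under eq_bigr do rewrite -ore_termE ore_coef_term.
have [kn|nk] := ltnP k n.
  rewrite (bigD1 (Ordinal kn)) //= eqxx big1 ?addr0 // => i.
  by rewrite -val_eqE /= => /negbTE ->.
by rewrite hn // big1 // => i _; rewrite ltn_eqF // (leq_trans _ nk).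
Qed.

Lemma ore_coefM n k p q : ore_below n p ->
  ore_coef k (p * q) = \sum_(i < n) ore_coef i p * ore_coef k (ore_h d ^+ i * q).
Proof.
move=> hn; rewrite {1}(ore_expand hn) mulr_suml.
rewrite (big_morph _ (ore_coefD k) (ore_coef0 d k)).
by apply: eq_bigr => i _; rewrite -mulrA ore_coefM_in.
Qed.

Lemma ore_coef_hX m n q : ore_below m.+1 q ->
  ore_coef (n + m) (ore_h d ^+ n * q) = ore_coef m q /\
  ore_below (n + m).+1 (ore_h d ^+ n * q).
Proof.
move=> hm; elim: n => [|n [IH1 IH2]]; first by rewrite mul1r.
rewrite exprS -mulrA; split=> [|[//|k] nk].
  by rewrite addSn ore_coefM_h IH1 IH2 // der0 addr0.
by rewrite ore_coefM_h !IH2 ?der0 ?addr0 // ltnW.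
Qed.

(** The subleading coefficient in [h^m b = b h^m + m d(b) h^(m-1) + ...], for
    [m = n.+1]. *)
Lemma ore_coef_commutator n b :
  ore_coef n (ore_h d ^+ n.+1 * ore_in d b) = d b *+ n.+1.
Proof.
have b1 : ore_below 1 (ore_in d b).
  by move=> [|k] // _; rewrite ore_coef_in.
elim: n => [|n IHn]; first by rewrite ore_coefM_h0 ore_coef_in.
rewrite exprS -mulrA ore_coefM_h IHn.
have [+ _] := ore_coef_hX n.+1 b1; rewrite addn0 ore_coef_in => ->.
by rewrite [RHS]mulrSr.
Qed.

Lemma ore_domain : (1 : A) <> 0 ->
  (forall a b, a * b = 0 -> a = 0 \/ b = 0) -> domain O.
Proof.
move=> A1 Adom; split=> [h|p q pq].
  apply: A1; have := congr1 (ore_coef 0) h.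
  by rewrite -(rmorph1 (ore_in d)) ore_coef_in ore_coef0.
have [p0|/ore_leading[n [pn hn]]] := pselect (p = 0); first by left.
have [q0|/ore_leading[m [qm hm]]] := pselect (q = 0); first by right.
have := congr1 (ore_coef (n + m)) pq; rewrite (ore_coefM _ _ hn) ore_coef0.
rewrite big_ord_recr big1 /= ?add0r => [|i _]; last first.
  by have [_ ->] := ore_coef_hX i hm; rewrite ?mulr0 ?ltn_add2r.
have [-> _] := ore_coef_hX n hm.
by move=> /Adom[].
Qed.

Hypothesis mulA_comm : forall a b, a * b = b * a.

(** The leading terms of [p b] and [b p] cancel, and so do the contributions of the
    coefficient of index [n] of [p] at [h^n]; only the derivative of [b] against
    the leading coefficient of [p] survives. *)
Lemma ore_commutator_degree n p b : ore_below n.+2 p ->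
  let q := p * ore_in d b - ore_in d b * p in
  ore_below n.+1 q /\ ore_coef n q = ore_coef n.+1 p * (d b *+ n.+1).
Proof.
move=> hp q.
have b1 : ore_below 1 (ore_in d b) by move=> [|k] // _; rewrite ore_coef_in.
have topE k : ore_coef k (ore_h d ^+ k * ore_in d b) = b.
  by have [+ _] := ore_coef_hX k b1; rewrite addn0 ore_coef_in.
have belowE k i : (i < k)%N -> ore_coef k (ore_h d ^+ i * ore_in d b) = 0.
  by move=> ik; have [_ ->] := ore_coef_hX i b1; rewrite ?addn0.
have qE k : ore_coef k q = \sum_(i < n.+2)
    ore_coef i p * ore_coef k (ore_h d ^+ i * ore_in d b) - b * ore_coef k p.
  rewrite -(ore_coefM _ _ hp) -ore_coefM_in -[RHS]monalg.mcoeffB.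
  by [].
split=> [k|].
  rewrite leq_eqVlt => /predU1P[<-|nk].
    rewrite qE big_ord_recr /= topE mulA_comm big1 ?add0r ?subrr // => i _.
    by rewrite belowE ?mulr0.
  rewrite qE hp // mulr0 subr0 big1 // => i _.
  by rewrite belowE ?mulr0 // (leq_trans _ nk).
rewrite qE !big_ord_recr /= topE ore_coef_commutator big1 ?add0r => [|i _].
  by rewrite [ore_coef n p * b]mulA_comm addrAC subrr add0r.
by rewrite belowE ?mulr0.
Qed.

(** Commutators with [b] lower the degree of an element of a nonzero ideal until it
    meets the coefficient ring; the intersection is [d]-stable because
    [h a - a h = d a]. *)
Lemma ore_simple b : (1 : A) <> 0 ->
  (forall n : nat, n.+1%:R != 0 :> K) ->
  (forall a a', a * a' = 0 -> a = 0 \/ a' = 0) -> d b <> 0 ->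
  (forall J : A -> Prop, two_sided_ideal J -> (forall a, J a -> J (d a)) ->
     (exists2 a, J a & a <> 0) -> J 1) -> simple_ring O.
Proof.
move=> A1 char0 Adom db dsimple; have [O1 _] := ore_domain A1 Adom.
split=> // I [I0 ID Il Ir].
have [I00|nI] := pselect (forall p, I p -> p = 0); [by left|right].
have [p [Ip p0]] : exists p, I p /\ p <> 0.
  apply: contrapT => h; apply: nI => p Ip; apply: contrapT => p0.
  by apply: h; exists p.
(* Characteristic zero enters here: the subleading coefficient is a multiple
   of [d b] by the degree. *)
have natK (a : A) k : a *+ k.+1 = 0 -> a = 0.
  rewrite -mulr_natl -(rmorph_nat (@scal K A)) => h.
  by rewrite -(scalK a (char0 k)) h mulr0.
have IN q : I q -> I (- q) by rewrite -mulN1r; apply: Il.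
have [n hn] := ore_below_exists p.
have [a Ia a0] : exists2 a, I (ore_in d a) & a <> 0.
  elim: n p Ip p0 hn => [p _ p0 /ore_below0 //|n IHn p Ip p0 hn].
  have [c0|c0] := pselect (ore_coef n p = 0).
    apply: (IHn p) => // k; rewrite leq_eqVlt => /predU1P[<- //|]; exact: hn.
  case: n IHn hn c0 => [|n] IHn hn c0.
    exists (ore_coef 0 p) => //.
    by rewrite (ore_expand hn) big_ord1 mulr1 in Ip.
  have [qlt qn] := ore_commutator_degree b hn.
  apply: (IHn _ _ _ qlt); first by apply: ID; [apply: Ir|apply/IN/Il].
  move=> q0; move: qn; rewrite q0 ore_coef0 => /esym/Adom[//|].
  by move=> /natK.
have I1 : I 1.
  rewrite -(rmorph1 (ore_in d)).
  apply: (dsimple (fun a => I (ore_in d a))); last by exists a.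
  - split=> [|x y hx hy|x y hy|x y hy].
    + by rewrite rmorph0.
    + by rewrite rmorphD; apply: ID.
    + by rewrite rmorphM; apply: Il.
    + by rewrite rmorphM; apply: Ir.
  - by move=> x hx; rewrite -ore_h_comm; apply: ID; [apply: Il|apply/IN/Ir].
by move=> q; rewrite -[q]mulr1; apply: Il.
Qed.

End OreLeadingTerms.

Section Transport.
Variables (K : fieldType) (A B : pzAlgType K) (phi : {rmorphism A -> B}).
Hypothesis phi_iso : alg_iso phi.

Lemma iso_domain : domain B -> domain A.
Proof.
have [_ /bij_inj phi_inj] := phi_iso.
move=> [B1 Bdom]; split=> [h|a b ab].
  by apply: B1; rewrite -(rmorph1 phi) h rmorph0.
have /Bdom[h|h] : phi a * phi b = 0 by rewrite -rmorphM ab rmorph0.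
- by left; apply: phi_inj; rewrite h rmorph0.
- by right; apply: phi_inj; rewrite h rmorph0.
Qed.

Lemma iso_simple : simple_ring B -> simple_ring A.
Proof.
have [psi [_ phiK psiK]] := alg_iso_inverse phi_iso.
move=> [B1 Bsimple]; split=> [h|I [I0 ID Il Ir]].
  by apply: B1; rewrite -(rmorph1 phi) h rmorph0.
have [|h|h] := Bsimple (fun b => I (psi b)).
- split=> [|x y hx hy|x y hy|x y hy].
  + by rewrite rmorph0.
  + by rewrite rmorphD; apply: ID.
  + by rewrite rmorphM; apply: Il.
  + by rewrite rmorphM; apply: Ir.
- by left=> a Ia; rewrite -[a]phiK (h (phi a)) ?rmorph0 // phiK.
- by right=> a; rewrite -[a]phiK.
Qed.

End Transport.

(** * The degenerate Ore extension *)

Section Zerodivisors.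
Variables (K : fieldType) (L : pzAlgType K) (d : derivation L) (a b : L).
Hypothesis mul_comm : forall x y : L, x * y = y * x.
Hypothesis da : d a = a.
Hypothesis ab : a * b = 0.
Hypothesis a0 : a <> 0.
Hypothesis b0 : b <> 0.

Lemma ore_in_inj : injective (ore_in d).
Proof.
move=> x y /(congr1 (ore_coef 0)).
by rewrite !ore_coef_in.
Qed.

(** The element [a] is normal, since [h a = a (h + 1)]; hence its right multiples form
    a two-sided ideal, and it is proper because [b] kills it. *)
Lemma ore_not_simple : ~ simple_ring (ore_ext d).
Proof.
move=> [_ simple]; pose I p := exists q, p = ore_in d a * q.
have normal p : exists q, p * ore_in d a = ore_in d a * q.
  elim/ore_ind_mul: p => [x||p q [p' hp] [q' hq]|p q [p' hp] [q' hq]].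
  - by exists (ore_in d x); rewrite -!rmorphM mul_comm.
  - exists (ore_h d + 1); rewrite mulrDr mulr1 addrC.
    by have /eqP := ore_h_comm d a; rewrite subr_eq da => /eqP.
  - by exists (p' + q'); rewrite mulrDl mulrDr hp hq.
  - by exists (p' * q'); rewrite -mulrA hq [p * _]mulrA hp -mulrA.
have Iideal : two_sided_ideal I.
  split=> [|_ _ [p ->] [q ->]|p _ [q ->]|p _ [q ->]].
  - by exists 0; rewrite mulr0.
  - by exists (p + q); rewrite mulrDr.
  - by have [p' hp] := normal p; exists (p' * q); rewrite [p * _]mulrA hp mulrA.
  - by exists (q * p); rewrite mulrA.
case: (simple I Iideal) => [I0|I1].
  apply: a0; apply: ore_in_inj; rewrite rmorph0; apply: I0.
  by exists 1; rewrite mulr1.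
have [q q1] := I1 1; apply: b0; apply: ore_in_inj.
by rewrite -[LHS]mulr1 q1 mulrA -rmorphM mul_comm ab !rmorph0 mul0r.
Qed.

Lemma ore_not_domain : ~ domain (ore_ext d).
Proof.
move=> [_ /(_ (ore_in d a) (ore_in d b))].
by rewrite -rmorphM ab rmorph0 => /(_ erefl)[]; rewrite -(rmorph0 (ore_in d));
  move/ore_in_inj.
Qed.

End Zerodivisors.

(** * The generic Ore extension *)

Section LaurentOre.
Variables (K : fieldType).
Hypothesis char0 : forall n : nat, n.+1%:R != 0 :> K.
Local Notation F := {fraction {poly K}}.
Local Notation e := (laurent_e K).
Local Notation lin0 := (loc_in ('X : {poly K})).
Variables (gL : laurent K) (d : derivation (laurent K)).
Hypothesis dE : forall p, d (lin0 p) = lin0 ('X * p^`()).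
Variable d' : derivation (loc gL).
Hypothesis hd' : der_extends (loc_in gL) d d'.
Hypothesis gL0 : gL <> 0.

Lemma laurent_separated : separated gL.
Proof.
have [phi [hphi phi_inj _]] := laurent_embedding K.
move=> a ha; apply: (phi_inj); rewrite rmorph0; apply: ha => //.
by apply/eqP => h; apply: gL0; apply: (phi_inj); rewrite h rmorph0.
Qed.

Lemma laurent_loc_embedding :
  exists phi : {rmorphism loc gL -> F}, injective phi.
Proof.
have [phi [hphi phi_inj phiE]] := laurent_embedding K.
have phig : phi gL != 0.
  by apply/eqP => h; apply: gL0; apply: (phi_inj); rewrite h rmorph0.
have [||psi [_ psiE _]] := @loc_univ K _ F gL phi (phi gL)^-1 hphi.
- by rewrite divff.
- by rewrite mulVf.
exists psi; apply: raddf_inj => x x0.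
have [a [n xa]] := loc_num (@laurent_comm K) x.
apply: (loc_num0 (n := n)); rewrite xa.
suff -> : a = 0 by rewrite rmorph0.
by apply: (phi_inj); rewrite -psiE -xa rmorphM x0 mul0r rmorph0.
Qed.

Lemma deriv_lt (p : {poly K}) : (1 < size p)%N ->
  p^`() != 0 /\ (size p^`() < size p)%N.
Proof.
move=> p1; have p0 : p != 0 by rewrite -size_poly_gt0 ltnW.
split; last exact: lt_size_deriv.
apply/eqP => /(congr1 (fun q : {poly K} => q`_(size p).-2)) /eqP.
rewrite coef_deriv coef0.
have -> : (size p).-2.+1 = (size p).-1 by case: (size p) p1 => [|[]].
rewrite -mulr_natr mulf_eq0 -lead_coefE lead_coef_eq0 (negbTE p0) /=.
by case: (size p) p1 => [|[|n]] //= _; apply/negP/char0.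
Qed.

(** Clearing denominators and powers of [e], a nonzero ideal contains a nonzero
    polynomial [p] in [e]; as [e] is a unit, stability under [X d/dX] gives [p'],
    of smaller degree and nonzero in characteristic zero until [p] is
    constant. *)
Lemma laurent_loc_der_simple (J : loc gL -> Prop) :
  two_sided_ideal J -> (forall a, J a -> J (d' a)) ->
  (exists2 a, J a & a <> 0) -> J 1.
Proof.
move=> [J0 JD Jl Jr] Jd [x Jx x0].
pose j p := loc_in gL (lin0 p).
have [a [n xa]] := loc_num (@laurent_comm K) x.
have polyC_mulC (p q : {poly K}) : p * q = q * p by apply: mulrC.
have [p [m ap]] := loc_num polyC_mulC a.
have Jp : J (j p).
  by rewrite /j -ap rmorphM /= -xa; apply/Jr/Jr.
have p0 : p != 0.
  apply/eqP => p0; apply: (x0); apply: (loc_num0 (n := n)).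
  rewrite xa; suff -> : a = 0 by rewrite rmorph0.
  by apply: (loc_num0 (n := m)); rewrite ap p0 rmorph0.
have Jderiv q : J (j q) -> J (j q^`()).
  move=> /Jd; rewrite hd' dE rmorphM rmorphM => /(Jl (loc_in gL (loc_inv 'X))).
  by rewrite mulrA -rmorphM loc_mulVr rmorph1 mul1r.
elim: (size p) {-2}p (leqnn (size p)) p0 Jp => [|k IHk] {ap}q qk q0 Jq.
  by rewrite leqn0 size_poly_eq0 (negbTE q0) in qk.
have [q1|q1] := ltnP 1%N (size q).
  have [dq0 dq] := deriv_lt q1.
  by apply: IHk dq0 (Jderiv _ Jq); rewrite -ltnS (leq_trans dq).
have /size_poly1P[k0 k0_neq qE] : size q == 1%N.
  by rewrite eqn_leq q1 size_poly_gt0.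
have := Jl (k0^-1)%:K _ Jq; rewrite /j qE -[k0%:P]/(k0%:K : {poly K}).
by rewrite !loc_in_scal -rmorphM mulVf // rmorph1.
Qed.

Lemma laurent_ore_simple_domain :
  simple_ring (ore_ext d') /\ domain (ore_ext d').
Proof.
have [phi phi_inj] := laurent_loc_embedding.
have L1 : (1 : loc gL) <> 0.
  move=> /(congr1 phi)/eqP; rewrite rmorph1 rmorph0 oner_eq0.
  by [].
have Ldom (a b : loc gL) : a * b = 0 -> a = 0 \/ b = 0.
  move=> /(congr1 phi)/eqP; rewrite rmorphM rmorph0 mulf_eq0.
  by case/orP=> /eqP h; [left|right]; apply: (phi_inj); rewrite h rmorph0.
split; last exact: ore_domain.
apply: (@ore_simple K _ d' _ (loc_in gL e)) => //.
- exact/loc_comm/laurent_comm.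
- rewrite hd' dE derivX mulr1 -[lin0 'X]/e => h; apply: L1.
  rewrite -(rmorph1 (loc_in gL)) -(loc_mulVr ('X : {poly K})) rmorphM h.
  by rewrite mulr0.
- exact: laurent_loc_der_simple.
Qed.

End LaurentOre.

(** * The two cases *)

Section Cases.
Variables (K : fieldType) (lambda alpha s : K).
Hypothesis char0 : forall n : nat, n.+1%:R != 0 :> K.
Hypothesis lambda_neq0 : lambda != 0.
Hypothesis s_sqrt : s ^+ 2 = 2%:R * lambda.
Let c := alpha / (2%:R * s).
Local Notation kappa := (s ^+ 2 - c ^+ 2).

Let two_neq0 : 2%:R != 0 :> K := char0 1.

Let s_neq0 : s != 0.
Proof.
by apply: contraNneq lambda_neq0 => s0; rewrite -(mulKf two_neq0 lambda) -s_sqrt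
  s0 expr0n mulr0.
Qed.

Let alphaE : alpha = 2%:R * s * c.
Proof. by rewrite /c mulrC divfK // mulf_neq0. Qed.

Let alpha_s : alpha / s = 2%:R * c.
Proof. by rewrite {1}alphaE mulrAC mulfK. Qed.

Let kappaE : 4%:R * s ^+ 2 * kappa = (4%:R * lambda - alpha) * (4%:R * lambda + alpha).
Proof.
have -> : 4%:R * lambda = 2%:R * s ^+ 2 by rewrite s_sqrt mulrA -natrM.
by rewrite alphaE; ring.
Qed.

Let gtilde_const :
  (8%:R * lambda)^-1 * (alpha ^+ 2 - 16%:R * lambda ^+ 2) = - kappa.
Proof.
have l8 : 8%:R * lambda = 4%:R * s ^+ 2 by rewrite s_sqrt mulrA -natrM.
have u0 : 4%:R * s ^+ 2 != 0 by rewrite mulf_neq0 ?expf_neq0 // (char0 3).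
apply: (mulfI u0); rewrite l8 mulVKf // mulrN kappaE.
by ring.
Qed.

(** As [f = kappa e^-1], the polynomial [gtilde] factors as
    [e (e - f + alpha / s)], and [e] is the unit between it and [- 2 s g]. *)
Lemma generic_case : kappa != 0 ->
    let hB := Bh lambda alpha s in
    let eB := Be lambda alpha s in
    let gB := gtilde lambda alpha s eB in
    let e := laurent_e K in
    let gL := gtilde lambda alpha s e in
    exists (d : derivation (laurent K)) (d' : derivation (loc gL)),
      [/\ determined_by (fun D => D e = e) d,
          determined_by (der_extends (loc_in gL) d) d',
          (exists phi : {rmorphism B lambda alpha s -> ore_ext d},
             [/\ alg_iso phi, phi hB = ore_h d & phi eB = ore_in d e]),
          [/\ ore_localization gB (loc_in gB),
              (exists psi : {rmorphism Ualpha lambda alpha -> loc gB},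
                 alg_iso psi /\ forall b, psi (Bval b) = loc_in gB b)
            & (exists chi : {rmorphism loc gB -> ore_ext d'},
                 [/\ alg_iso chi, chi (loc_in gB hB) = ore_h d'
                   & chi (loc_in gB eB) = ore_in d' (loc_in gL e)])]
        & simple_ring (Ualpha lambda alpha) /\ domain (Ualpha lambda alpha)].
Proof.
move=> kappa0 hB eB gB e gL.
have [d d_det dE] := laurent_derivation K.
have [d' d'_det] := loc_derivation gL d.
have [de _] := d_det; have [hd' _] := d'_det.
have hyp := laurent_hyperbola kappa0.
set f := laurent_f kappa in hyp.
have te : loc_inv 'X * e = 1 := loc_mulVr _.
have df : d f = - f.
  rewrite /f /laurent_f derM der_scal mul0r add0r (der_inv _ (loc_mulV _) te).
  by rewrite de te mul1r mulrN.
have gLE : gL = e * (e - f + (2%:R * c)%:K).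
  rewrite mulrDr mulrBr (hyp_rel hyp) /gL /gtilde alpha_s gtilde_const.
  by rewrite rmorphN scalC expr2 addrAC.
have gL0 : gL <> 0.
  pose q : {poly K} := gtilde lambda alpha s 'X.
  have -> : gL = loc_in 'X q.
    rewrite /q /gtilde (rmorphD (loc_in 'X)) (rmorphD (loc_in 'X)).
    by rewrite (rmorphM (loc_in 'X)) (rmorphXn (loc_in 'X)) /= !loc_in_scal.
  have [phi [_ _ phiE]] := laurent_embedding K.
  move=> /(congr1 phi)/eqP; rewrite phiE rmorph0 tofrac_eq0 => /eqP.
  (* As a polynomial in [e], [gtilde] is monic of degree two. *)
  move=> /(congr1 (fun p : {poly K} => p`_2)) /eqP; rewrite /q /gtilde.
  rewrite !coefD coefXn coefCM coefX coefC coef0 mulr0 !addr0.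
  by rewrite oner_eq0.
have sep := laurent_separated gL0.
have [|phi_ex loc_gB psi_ex chi_ex] := @B_localization K lambda alpha s c
  two_neq0 s_neq0 s_sqrt alphaE _ e f d hyp de df gL _ _ (loc_mulV _) gLE sep
  d' hd' gB.
  move=> phi hphi phie _; rewrite /gB /gL /gtilde.
  rewrite !(rmorphD phi) (rmorphXn phi) (rmorphM phi) phie !hphi.
  by rewrite !(rmorphD (ore_in d)) (rmorphXn (ore_in d)) (rmorphM (ore_in d)).
exists d, d'; split=> //.
- by have [phi [? ? ? _]] := phi_ex; exists phi.
- by split=> //; have [chi [? ? ? _]] := chi_ex; exists chi.
have [Phi [isoPhi _ _ _]] := @Ualpha_ore K lambda alpha s c
  two_neq0 s_neq0 s_sqrt alphaE _ e f d hyp de df gL _ _ (loc_mulV _) gLE d' hd'.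
have [sO dO] := laurent_ore_simple_domain char0 dE hd' gL0.
by split; [apply: iso_simple isoPhi sO|apply: iso_domain isoPhi dO].
Qed.

(** Here [g'] is [- 2 s g] itself, and the generic points of the two lines show
    that [e] and [f] survive the localization. *)
Lemma degenerate_case : kappa = 0 ->
    let hB := Bh lambda alpha s in
    let eB := Be lambda alpha s in
    let fB := Bf lambda alpha s in
    let gB := gprime alpha s eB fB in
    let e := cross_e K in
    let f := cross_f K in
    let gL := gprime alpha s e f in
    exists (d : derivation (cross K)) (d' : derivation (loc gL)),
      [/\ determined_by (fun D => D e = e /\ D f = - f) d,
          determined_by (der_extends (loc_in gL) d) d',
          (exists phi : {rmorphism B lambda alpha s -> ore_ext d},
             [/\ alg_iso phi, phi hB = ore_h d, phi eB = ore_in d e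
               & phi fB = ore_in d f]),
          [/\ ore_localization gB (loc_in gB),
              (exists psi : {rmorphism Ualpha lambda alpha -> loc gB},
                 alg_iso psi /\ forall b, psi (Bval b) = loc_in gB b)
            & (exists chi : {rmorphism loc gB -> ore_ext d'},
                 [/\ alg_iso chi, chi (loc_in gB hB) = ore_h d',
                     chi (loc_in gB eB) = ore_in d' (loc_in gL e)
                   & chi (loc_in gB fB) = ore_in d' (loc_in gL f)])]
        & ~ simple_ring (Ualpha lambda alpha)
          /\ ~ domain (Ualpha lambda alpha)].
Proof.
move=> kappa0 hB eB fB gB e f gL.
have [d d_det] := cross_derivation K.
have [d' d'_det] := loc_derivation gL d.
have [[de df] _] := d_det; have [hd' _] := d'_det.
have hyp := cross_hyperbola K; rewrite -[X in is_hyperbola _ _ X]kappa0 in hyp.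
have gLE : gL = 1 * (e - f + (2%:R * c)%:K) by rewrite mul1r -alpha_s.
have sep : separated gL := @cross_separated K (alpha / s).
have [|phi_ex loc_gB psi_ex chi_ex] := @B_localization K lambda alpha s c
  two_neq0 s_neq0 s_sqrt alphaE _ e f d hyp de df gL _ _ (mulr1 1) gLE sep
  d' hd' gB.
  move=> phi hphi phie phif; rewrite /gB /gL /gprime.
  rewrite (rmorphD phi) (rmorphB phi) phie phif hphi.
  by rewrite (rmorphD (ore_in d)) (rmorphB (ore_in d)).
exists d, d'; split=> //.
have [Phi [isoPhi _ _ _]] := @Ualpha_ore K lambda alpha s c
  two_neq0 s_neq0 s_sqrt alphaE _ e f d hyp de df gL _ _ (mulr1 1) gLE d' hd'.
have [Psi [isoPsi _ _]] := alg_iso_inverse isoPhi.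
have tofracX : tofrac 'X != 0 :> {fraction {poly K}}.
  by rewrite tofrac_eq0 polyX_eq0.
have lin_inj := separated_loc_inj sep.
have e0 : loc_in gL e <> 0.
  rewrite -(rmorph0 (loc_in gL)) => /lin_inj he.
  have [phi [_ phie _]] := cross_branch (mulr0 ('X : {poly K})).
  by move/eqP: tofracX; apply; rewrite -phie -/e he rmorph0.
have f0 : loc_in gL f <> 0.
  rewrite -(rmorph0 (loc_in gL)) => /lin_inj hf.
  have [phi [_ _ phif]] := cross_branch (mul0r ('X : {poly K})).
  by move/eqP: tofracX; apply; rewrite -phif -/f hf rmorph0.
have ef0 : loc_in gL e * loc_in gL f = 0.
  by rewrite -rmorphM cross_ef rmorph0.
have Lcomm := loc_comm (s := gL) (@cross_comm K).
have de' : d' (loc_in gL e) = loc_in gL e by rewrite hd' de.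
split=> [simple|dom].
- exact: (ore_not_simple Lcomm de' ef0 e0 f0 (iso_simple isoPsi simple)).
- exact: (ore_not_domain ef0 e0 f0 (iso_domain isoPsi dom)).
Qed.

Lemma kappa_eq0 :
  (kappa == 0) = (alpha == 4%:R * lambda) || (alpha == - (4%:R * lambda)).
Proof.
have u0 : 4%:R * s ^+ 2 != 0 by rewrite mulf_neq0 ?expf_neq0 // (char0 3).
rewrite -(inj_eq (mulfI u0)) mulr0 kappaE mulf_eq0 subr_eq0 eq_sym.
by rewrite addrC addr_eq0.
Qed.

End Cases.

Theorem proposition4p3 (K : closedFieldType) (charK : [pchar K] =i pred0)
    (lambda alpha s : K) (lambda_neq0 : lambda != 0)
    (s_sqrt : s ^+ 2 = 2%:R * lambda) :
  (alpha != 4%:R * lambda -> alpha != - (4%:R * lambda) ->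
    let hB := Bh lambda alpha s in
    let eB := Be lambda alpha s in
    let gB := gtilde lambda alpha s eB in
    let e := laurent_e K in
    let gL := gtilde lambda alpha s e in
    exists (d : derivation (laurent K)) (d' : derivation (loc gL)),
      [/\ determined_by (fun D => D e = e) d,
          determined_by (der_extends (loc_in gL) d) d',
          (exists phi : {rmorphism B lambda alpha s -> ore_ext d},
             [/\ alg_iso phi, phi hB = ore_h d & phi eB = ore_in d e]),
          [/\ ore_localization gB (loc_in gB),
              (exists psi : {rmorphism Ualpha lambda alpha -> loc gB},
                 alg_iso psi /\ forall b, psi (Bval b) = loc_in gB b)
            & (exists chi : {rmorphism loc gB -> ore_ext d'},
                 [/\ alg_iso chi, chi (loc_in gB hB) = ore_h d'
                   & chi (loc_in gB eB) = ore_in d' (loc_in gL e)])]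
        & simple_ring (Ualpha lambda alpha) /\ domain (Ualpha lambda alpha)])
  /\
  (alpha = 4%:R * lambda \/ alpha = - (4%:R * lambda) ->
    let hB := Bh lambda alpha s in
    let eB := Be lambda alpha s in
    let fB := Bf lambda alpha s in
    let gB := gprime alpha s eB fB in
    let e := cross_e K in
    let f := cross_f K in
    let gL := gprime alpha s e f in
    exists (d : derivation (cross K)) (d' : derivation (loc gL)),
      [/\ determined_by (fun D => D e = e /\ D f = - f) d,
          determined_by (der_extends (loc_in gL) d) d',
          (exists phi : {rmorphism B lambda alpha s -> ore_ext d},
             [/\ alg_iso phi, phi hB = ore_h d, phi eB = ore_in d e
               & phi fB = ore_in d f]),
          [/\ ore_localization gB (loc_in gB),
              (exists psi : {rmorphism Ualpha lambda alpha -> loc gB},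
                 alg_iso psi /\ forall b, psi (Bval b) = loc_in gB b)
            & (exists chi : {rmorphism loc gB -> ore_ext d'},
                 [/\ alg_iso chi, chi (loc_in gB hB) = ore_h d',
                     chi (loc_in gB eB) = ore_in d' (loc_in gL e)
                   & chi (loc_in gB fB) = ore_in d' (loc_in gL f)])]
        & ~ simple_ring (Ualpha lambda alpha)
          /\ ~ domain (Ualpha lambda alpha)]).
Proof.
have char0 n : n.+1%:R != 0 :> K by move/pcharf0P: charK => ->.
have kE := kappa_eq0 alpha char0 lambda_neq0 s_sqrt.
split=> [a1 a2|a12].
- by apply: generic_case => //; rewrite kE negb_or a1 a2.
- apply: degenerate_case => //; apply/eqP; rewrite kE.
  by case: a12 => ->; rewrite eqxx ?orbT.
Qed.
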